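(* Let $0<p<1$, $0<q<1$, and let $\mathbf{x}_i(t)\in\mathbb{R}^d$ ($1\le i\le N_1$), $\mathbf{y}_j(t)\in\mathbb{R}^d$ ($1\le j\le N_2$), $t\ge 0$, solve the linear system $$\dot{\mathbf{x}}_i = \frac{1}{N_1}\sum_{i'\ne i}\psi^+_{i,i'}(\mathbf{x}_{i'}-\mathbf{x}_i)-\frac{1}{N_2}\sum_{j}\psi^-_{i,j}(\mathbf{y}_j-\mathbf{x}_i),\qquad \dot{\mathbf{y}}_j=\frac{1}{N_2}\sum_{j'\ne j}\psi^+_{j,j'}(\mathbf{y}_{j'}-\mathbf{y}_j)-\frac{1}{N_1}\sum_i\psi^-_{j,i}(\mathbf{x}_i-\mathbf{y}_j),$$ where the coefficients are constant in time and random: $\psi^+_{i,i'}\sim B(p)$, $\psi^+_{j,j'}\sim B(p)$, $\psi^-_{i,j}\sim B(q)$, independent and symmetric as described in the context. Assume that $N_1$ and $N_2$ are comparable, in the sense that there exists a constant $\kappa>0$ such that $$\frac1\kappa N_1\le N_2\le\kappa N_1 .$$ Then for sufficiently large $N=\min\{N_1,N_2\}$ (in terms of $p$, $q$ and $\kappa$), there exist constants $\lambda_-(N),\lambda_+(N)$ with $$\lambda_-(N)\le\frac{C(p,q,\alpha)}{N^{1-\alpha}},\qquad \lambda_+(N)\ge c(p,q,\alpha)N^{1-\alpha},\qquad\text{for any }0<\alpha<1,$$ (where $C(p,q,\alpha),c(p,q,\alpha)>0$ depend only on $p,q,\alpha$) such that, with large probability, the following holds: if the initial data satisfies $$\lambda(0):=\frac{\mathrm{var}(\mathbf{x}(0))+\mathrm{var}(\mathbf{y}(0))}{|\bar{\mathbf{x}}(0)-\bar{\mathbf{y}}(0)|^2}\le\lambda_+,$$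 then for all $t\ge0$ there holds the $L^2$ separation $$\lambda(t):=\frac{\mathrm{var}(\mathbf{x}(t))+\mathrm{var}(\mathbf{y}(t))}{|\bar{\mathbf{x}}(t)-\bar{\mathbf{y}}(t)|^2}\le\lambda_-+(\lambda(0)-\lambda_-)e^{-\mu t},\qquad\mu=p/2,$$ and the $L^\infty$ separation $$\tilde\lambda(t):=\frac{\max_i|\hat{\mathbf{x}}_i(t)|^2+\max_j|\hat{\mathbf{y}}_j(t)|^2}{|\bar{\mathbf{x}}(t)-\bar{\mathbf{y}}(t)|^2}\le C(p,q,\kappa,\alpha)\big(\lambda_-+\tilde\lambda(0)e^{-\mu t}\big),$$ where, for $0<\alpha<1$, $C(p,q,\kappa,\alpha)$ is a constant depending only on $p,q,\kappa,\alpha$.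
   Context: Indices $i,i'$ run from $1$ to $N_1$ and $j,j'$ from $1$ to $N_2$; $\sum_{i'\ne i}$ is the sum over $i'$ different from $i$ (similarly $\sum_{j'\ne j}$). The array $\psi^+_{i,i'}$ (interactions within the first group), the array $\psi^+_{j,j'}$ (interactions within the second group), and the array $\psi^-_{i,j}$ (interactions between groups) are three different arrays, with symmetry $\psi^+_{i,i'}=\psi^+_{i',i}$, $\psi^+_{j,j'}=\psi^+_{j',j}$, $\psi^-_{i,j}=\psi^-_{j,i}$. $B(p)$ denotes the Bernoulli distribution: value $1$ with probability $p$ and $0$ with probability $1-p$. Apart from the symmetry constraints, all the random variables $\psi^+_{i,i'}$, $\psi^+_{j,j'}$, $\psi^-_{i,j}$ are mutually independent. Notation: $\bar{\mathbf{x}}=\frac1{N_1}\sum_i\mathbf{x}_i$, $\bar{\mathbf{y}}=\frac1{N_2}\sum_j\mathbf{y}_j$, $\hat{\mathbf{x}}_i=\mathbf{x}_i-\bar{\mathbf{x}}$, $\hat{\mathbf{y}}_j=\mathbf{y}_j-\bar{\mathbf{y}}$, $\mathrm{var}(\mathbf{x})=\frac1{N_1}\sum_i|\hat{\mathbf{x}}_i|^2$, $\mathrm{var}(\mathbf{y})=\frac1{N_2}\sum_j|\hat{\mathbf{y}}_j|^2$. An event $\mathcal{A}_N$ depending on a large parameter $N$ happens with large probability if $\lim_{N\to\infty}P(\mathcal{A}_N)=1$. Here $N=\min\{N_1,N_2\}$, and $p,q,\kappa$ are fixed as $N\to\infty$. *)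

(* Defs.v *)
From HB Require Import structures.
From mathcomp Require Import all_boot all_order all_algebra.
From mathcomp Require Import all_classical all_reals all_analysis.
Import Order.TTheory GRing.Theory Num.Theory.
Import numFieldNormedType.Exports.

Set Implicit Arguments.
Unset Strict Implicit.
Unset Printing Implicit Defensive.

Local Open Scope classical_set_scope.
Local Open Scope ring_scope.

(* The norm provided by the library on ['rV[R]_d] is the sup norm, whereas the
   variances below are built on the Euclidean one. *)
Definition sqnorm (R : realType) (d : nat) (v : 'rV[R]_d) : R :=
  \sum_k v ord0 k ^+ 2.

Definition mean (R : realType) (d n : nat) (u : 'I_n -> 'rV[R]_d) : 'rV[R]_d :=
  n%:R^-1 *: \sum_i u i.

Definition deviation (R : realType) (d n : nat) (u : 'I_n -> 'rV[R]_d)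
    (i : 'I_n) : 'rV[R]_d :=
  u i - mean u.

Definition var (R : realType) (d n : nat) (u : 'I_n -> 'rV[R]_d) : R :=
  n%:R^-1 * \sum_i sqnorm (deviation u i).

Definition max_sqdev (R : realType) (d n : nat) (u : 'I_n -> 'rV[R]_d) : R :=
  \big[Num.max/0]_i sqnorm (deviation u i).

(* In both quotients a vanishing denominator gives the value [0]; statements
   using them must ensure [mean u != mean v]. *)
Definition lambda2 (R : realType) (d n m : nat)
    (u : 'I_n -> 'rV[R]_d) (v : 'I_m -> 'rV[R]_d) : R :=
  (var u + var v) / sqnorm (mean u - mean v).

Definition lambda_sup (R : realType) (d n m : nat)
    (u : 'I_n -> 'rV[R]_d) (v : 'I_m -> 'rV[R]_d) : R :=
  (max_sqdev u + max_sqdev v) / sqnorm (mean u - mean v).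

(* [psi1] and [psi2] are the interactions inside each group, and [psi12 i j] is
   the interaction between [x i] and [y j], used in both equations because that
   array is symmetric. Solutions are continuous on [0, +oo[ and satisfy the
   equations on ]0, +oo[; the one-sided derivatives at 0 then exist and satisfy
   the equations as well. *)
Definition solution (R : realType) (d N1 N2 : nat)
    (psi1 : 'I_N1 -> 'I_N1 -> R) (psi2 : 'I_N2 -> 'I_N2 -> R)
    (psi12 : 'I_N1 -> 'I_N2 -> R)
    (x : 'I_N1 -> R -> 'rV[R]_d) (y : 'I_N2 -> R -> 'rV[R]_d) : Prop :=
  [/\ forall i, {within `[0, +oo[, continuous (x i)},
      forall j, {within `[0, +oo[, continuous (y j)},
      forall (i : 'I_N1) (t : R), 0 < t ->
        is_derive t (1 : R) (x i)
          (N1%:R^-1 *: (\sum_(i' | i' != i) psi1 i i' *: (x i' t - x i t))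
           - N2%:R^-1 *: (\sum_j psi12 i j *: (y j t - x i t)))
    & forall (j : 'I_N2) (t : R), 0 < t ->
        is_derive t (1 : R) (y j)
          (N2%:R^-1 *: (\sum_(j' | j' != j) psi2 j j' *: (y j' t - y j t))
           - N1%:R^-1 *: (\sum_i psi12 i j *: (x i t - y j t)))].

Definition mutually_independent (d d' : measure_display)
    (T : measurableType d) (T' : measurableType d') (R : realType)
    (P : probability T R) (I : finType) (X : I -> {RV P >-> T'}) : Prop :=
  forall (J : {set I}) (B : I -> set T'), (forall i, measurable (B i)) ->
    (P (\bigcap_(i in [set` J]) (X i @^-1` B i)) =
     \prod_(i in J) P (X i @^-1` B i))%E.

Definition upair (n : nat) := {e : 'I_n * 'I_n | (e.1 < e.2)%N}.

(* Because of the symmetry, the independent variables within a group are those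
   with [i < i']. The diagonal ones do not enter the system and are left
   unconstrained. *)
Definition interaction_family (N1 N2 : nat) (V : Type)
    (psi1 : 'I_N1 -> 'I_N1 -> V) (psi2 : 'I_N2 -> 'I_N2 -> V)
    (psi12 : 'I_N1 -> 'I_N2 -> V)
    (e : upair N1 + upair N2 + 'I_N1 * 'I_N2) : V :=
  match e with
  | inl (inl e1) => psi1 (val e1).1 (val e1).2
  | inl (inr e2) => psi2 (val e2).1 (val e2).2
  | inr e12 => psi12 e12.1 e12.2
  end.

(* A variable with law B(p) is encoded as a [bool]-valued random variable; its
   numerical value is [b%:R]. *)
Record random_interactions (R : realType) (p q : R) (N1 N2 : nat) := {
  ri_disp : measure_display;
  ri_space : measurableType ri_disp;
  ri_prob : probability ri_space R;
  ri_psi1 : 'I_N1 -> 'I_N1 -> {RV ri_prob >-> bool};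
  ri_psi2 : 'I_N2 -> 'I_N2 -> {RV ri_prob >-> bool};
  ri_psi12 : 'I_N1 -> 'I_N2 -> {RV ri_prob >-> bool};
  ri_sym1 : forall i i' w, ri_psi1 i i' w = ri_psi1 i' i w;
  ri_sym2 : forall j j' w, ri_psi2 j j' w = ri_psi2 j' j w;
  ri_law1 : forall i i', i != i' ->
    distribution ri_prob (ri_psi1 i i') =1 bernoulli_prob p;
  ri_law2 : forall j j', j != j' ->
    distribution ri_prob (ri_psi2 j j') =1 bernoulli_prob p;
  ri_law12 : forall i j,
    distribution ri_prob (ri_psi12 i j) =1 bernoulli_prob q;
  ri_indep :
    mutually_independent (interaction_family ri_psi1 ri_psi2 ri_psi12)
}.

Definition random_solution (R : realType) (p q : R) (d N1 N2 : nat)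
    (S : random_interactions p q N1 N2) (w : ri_space S)
    (x : 'I_N1 -> R -> 'rV[R]_d) (y : 'I_N2 -> R -> 'rV[R]_d) : Prop :=
  solution (fun i i' => (ri_psi1 S i i' w : nat)%:R)
           (fun j j' => (ri_psi2 S j j' w : nat)%:R)
           (fun i j => (ri_psi12 S i j w : nat)%:R) x y.

(* [min N1 N2] tends to infinity among the pairs that are comparable with
   constant [kappa]; see [comparable_inftyP]. *)
Definition comparable_infty (R : realType) (kappa : R) : set_system (nat * nat) :=
  within [set n | kappa^-1 * n.1%:R <= n.2%:R :> R /\
                  n.2%:R <= kappa * n.1%:R :> R]
         (filter_prod \oo \oo).

Lemma comparable_inftyP (R : realType) (kappa : R) (A : set (nat * nat)) :
  comparable_infty kappa A <->
  exists M : nat, forall N1 N2 : nat,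
    kappa^-1 * N1%:R <= N2%:R :> R -> N2%:R <= kappa * N1%:R :> R ->
    (M <= minn N1 N2)%N -> A (N1, N2).
Proof.
split.
  move=> [[B1 B2] /= [[m1 _ h1] [m2 _ h2]] sB].
  exists (maxn m1 m2) => N1 N2 c1 c2; rewrite leq_min !geq_max.
  move=> /andP[/andP[l1 _] /andP[_ l2]].
  by apply: (sB (N1, N2)) => //; split; [exact: h1|exact: h2].
move=> [M h]; exists ([set n | (M <= n)%N], [set n | (M <= n)%N]) => /=.
  by split; exists M.
by move=> [N1 N2] /= [l1 l2] [c1 c2]; apply: h => //; rewrite leq_min l1.
Qed.

Definition large_probability (R : realType) (p q kappa : R)
    (S : forall N1 N2 : nat, random_interactions p q N1 N2)
    (A : forall N1 N2 : nat, set (ri_space (S N1 N2))) : Prop :=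
  (forall N1 N2, measurable (A N1 N2)) /\
  ri_prob (S n.1 n.2) (A n.1 n.2) @[n --> comparable_infty kappa] --> (1%E : \bar R).

(* Main.v *)
Require Import Defs.
From mathcomp Require Import all_boot all_order all_algebra.
From mathcomp Require Import all_classical all_reals all_analysis.
From mathcomp Require Import ring lra.
Import Order.TTheory GRing.Theory Num.Theory.
Import numFieldNormedType.Exports.

(** The argument has a deterministic half and a probabilistic half.

    Deterministic half. Write [u = x - mean x], [v = y - mean y],
    [D = mean x - mean y] and [V = var x + var y]. The interactions inside the
    groups cancel in the equations of the means, so that, with [qb] the average
    of the array between the groups,
      [(|D|^2)' = 4 qb |D|^2 + 4 D.E],
    where [E] pairs [u] and [v] with the deviations of the row and column
    averages of that array from [q]. If these deviations are at most [del], then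
    [|E|^2 <= 2 del^2 V]. Each inner graph Laplacian has spectral gap close to
    [p], and the repulsion between the groups is bounded by the row and column
    averages alone, whence
      [V' <= (- 2 p + 4 q + small) V + 2 D.E].
    The rate [4 q] is the one at which [|D|^2] grows, so the quotient [V / |D|^2]
    decays at rate about [2 p], up to the terms in [E]. These are absorbed
    between the two thresholds
      [lambda_- = 16 del^2 / p^2] and [lambda_+ = p^2 / (128 del^2)].
    Rather than differentiating the quotient, which would require knowing beforehand
    that it stays defined and below [lambda_+], one considers
    [F = V - g |D|^2] with [g t = lambda_- + (lambda 0 - lambda_-) exp (- mu t)]:
    it satisfies the linear inequality [F' <= (4 q - p) F]
    ([total_spread_sub_gap_rate]), so it stays nonpositive by Gronwall's lemma
    ([spread_le_gap]), and this in turn keeps [|D|] positive ([gap_gt0]). A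
    single squared deviation [|u_i|^2] is damped at rate [p] by the degree of
    [i]; the other agents act on it only through [V] and [|D|^2], and the same
    comparison with a multiple of [(lambda_- + lambda_sup 0 exp (- mu t)) |D|^2]
    gives the uniform bound ([sqnorm_deviation_le]). Every inequality is
    quadratic, hence is proved for scalar coordinates and summed.

    Probabilistic half. With [B] the centered adjacency matrix of a group of
    size [n], an edge that occurs once in a product of entries kills its
    expectation, so the expected squared Frobenius norm of [B^2] is at most
    [2 n^3] ([expect_frobenius_le]). By Markov's inequality the operator norm of
    [B] is below [eps n] with probability [1 - O(1/n)], which yields the spectral
    gap ([laplacian_gap]). Degrees and row averages are controlled by Chernoff's
    inequality ([chernoff_mass]). For [del = 4 ln N / sqrt N] the union over all
    rows of the tails still vanishes, and [del^2 = 16 (ln N)^2 / N] is below a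
    constant times [N^(alpha - 1)] for every [alpha > 0] simultaneously. All these
    estimates are finite sums over the configurations of the independent edges,
    since independence gives each configuration its product weight
    ([probability_config_le_mass]). *)

Set Implicit Arguments.
Unset Strict Implicit.
Unset Printing Implicit Defensive.

Local Open Scope classical_set_scope.
Local Open Scope ring_scope.

(** * Differentiable trajectories and Gronwall's lemma *)

(** One-sided continuity at [0] is kept apart from differentiability on
    ]0, +oo[, as in [solution]: this class is stable under the algebraic
    operations and is what the monotonicity criterion on [0, +oo[ consumes. *)
Definition trajectory (R : realType) (f f' : R -> R) : Prop :=
  {within `[0, +oo[, continuous f} /\
  forall t : R, 0 < t -> is_derive t (1 : R) f (f' t).

Section Trajectories.
Variable R : realType.
Implicit Types (f g : R -> R).

Lemma eq_trajectory f f1 f' f1' : f =1 f1 -> (forall t, 0 < t -> f' t = f1' t) ->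
  trajectory f f' -> trajectory f1 f1'.
Proof.
move=> /funext <- e [cf df]; split=> // t t0.
by rewrite -e //; exact: df.
Qed.

Lemma trajectory_cst (a : R) : trajectory (cst a) (cst 0).
Proof.
by split=> [x|t _]; [exact: cvg_cst|exact: is_derive_cst].
Qed.

Lemma trajectoryD f g f' g' : trajectory f f' -> trajectory g g' ->
  trajectory (fun t => f t + g t) (fun t => f' t + g' t).
Proof.
move=> [cf df] [cg dg]; split=> [x|t t0].
  by apply: cvgD; [exact: cf|exact: cg].
by have := is_deriveD (df t t0) (dg t t0).
Qed.

Lemma trajectoryM f g f' g' : trajectory f f' -> trajectory g g' ->
  trajectory (fun t => f t * g t) (fun t => f' t * g t + f t * g' t).
Proof.
move=> [cf df] [cg dg]; split=> [x|t t0].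
  by apply: cvgM; [exact: cf|exact: cg].
have := is_deriveM (df t t0) (dg t t0).
by rewrite /GRing.scale /= [_ + g t * _]addrC [g t * _]mulrC.
Qed.

Lemma trajectoryZ (a : R) f f' : trajectory f f' ->
  trajectory (fun t => a * f t) (fun t => a * f' t).
Proof.
move=> /(trajectoryM (trajectory_cst a)).
by apply: eq_trajectory => // t _; rewrite mul0r add0r.
Qed.

Lemma trajectoryB f g f' g' : trajectory f f' -> trajectory g g' ->
  trajectory (fun t => f t - g t) (fun t => f' t - g' t).
Proof.
move=> hf /(trajectoryZ (-1)) /(trajectoryD hf).
by apply: eq_trajectory => t; rewrite mulN1r.
Qed.

Lemma trajectory_sqr f f' : trajectory f f' ->
  trajectory (fun t => f t ^+ 2) (fun t => 2 * (f t * f' t)).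
Proof.
move=> hf; have := trajectoryM hf hf.
by apply: eq_trajectory => [t|t _]; ring.
Qed.

Lemma trajectory_sum (I : Type) (s : seq I) (f f' : I -> R -> R) :
  (forall i, trajectory (f i) (f' i)) ->
  trajectory (fun t => \sum_(i <- s) f i t) (fun t => \sum_(i <- s) f' i t).
Proof.
move=> h; elim: s => [|i s IH].
  by have := trajectory_cst 0; apply: eq_trajectory => t *; rewrite big_nil.
have := trajectoryD (h i) IH.
by apply: eq_trajectory => t *; rewrite big_cons.
Qed.

Lemma trajectory_expR (k : R) :
  trajectory (fun t => expR (k * t)) (fun t => k * expR (k * t)).
Proof.
have dE (t : R) : is_derive t (1 : R) (fun t => expR (k * t)) (k * expR (k * t)).
  rewrite mulrC.
  apply: is_derive1_comp.
  by rewrite -[X in is_derive _ _ _ X]mulr1; exact: is_deriveZ.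
split=> [|t _]; last exact: dE.
apply: continuous_subspaceT => t.
by apply: differentiable_continuous; apply/derivable1_diffP; case: (dE t).
Qed.

(** Multiplying by the integrating factor [exp (- k t)] turns the inequality
    into monotonicity. This is what lets
    barriers be propagated without a continuation argument. *)
Lemma gronwall_le0 (k : R) f f' : trajectory f f' ->
  (forall t, 0 < t -> f' t <= k * f t) -> f 0 <= 0 ->
  forall t, 0 <= t -> f t <= 0.
Proof.
move=> hf hk f0 t t0.
have [cF dF] := trajectoryM (trajectory_expR (- k)) hf.
have := @ler0_derive1_nincry _ (fun t => expR (- k * t) * f t) 0.
have ge0 x : x \in `]0, +oo[ -> 0 < x by rewrite in_itv /= andbT.
move=> /(_ _ _ cF 0 t (lexx _) t0) H.
have {H}: expR (- k * t) * f t <= expR (- k * 0) * f 0.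
  apply: H => x /ge0 x0; first by case: (dF x x0).
  rewrite derive1E; have [_ ->] := dF x x0.
  have := ler_wpM2l (expR_ge0 (- k * x)) (hk x x0); lra.
rewrite mulr0 expR0 mul1r => /le_trans /(_ f0).
by rewrite pmulr_rle0 ?expR_gt0.
Qed.

End Trajectories.

Lemma trajectory_coord (R : realType) (d : nat) (x : R -> 'rV[R]_d)
    (x' : R -> 'rV[R]_d) (k : 'I_d) :
  {within `[0, +oo[, continuous x} ->
  (forall t : R, 0 < t -> is_derive t (1 : R) x (x' t)) ->
  trajectory (fun t => x t ord0 k) (fun t => x' t ord0 k).
Proof.
move=> cx dx; split=> [t|t t0].
  exact: continuous_comp (cx t) (@coord_continuous _ _ _ ord0 k _).
have [h1 h2] := dx t t0.
split; first by move/derivable_mxP: h1; exact.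
by rewrite -h2 derive_mx // mxE.
Qed.

(** * Spectral gap of a graph with small centered adjacency matrix *)

(** The adjacency matrix minus its mean, with a zero diagonal. *)
Definition centered (R : pzRingType) (n : nat) (p : R) (psi : 'I_n -> 'I_n -> R)
    (i k : 'I_n) : R :=
  if i == k then 0 else psi i k - p.

(** The last condition bounds the squared Frobenius norm of the square of the
    centered adjacency matrix; it is a sum of fourth order monomials, hence
    accessible to a moment computation, and it controls the operator norm. *)
Definition well_mixed (R : realFieldType) (n : nat) (p eps : R)
    (psi : 'I_n -> 'I_n -> R) : Prop :=
  [/\ forall i k, psi i k = psi k i,
      forall i k, 0 <= psi i k <= 1,
      forall i, (p - eps) * n%:R <= \sum_(k | k != i) psi i k
    & \sum_i \sum_k (\sum_l centered p psi i l * centered p psi l k) ^+ 2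
        <= (eps * n%:R) ^+ 4].

Section SpectralGap.
Variable R : realFieldType.

Lemma cauchy_schwarz_sum (I : finType) (a b : I -> R) :
  (\sum_i a i * b i) ^+ 2 <= (\sum_i a i ^+ 2) * (\sum_i b i ^+ 2).
Proof.
have : 0 <= \sum_i \sum_j (a i * b j - a j * b i) ^+ 2.
  by do 2 (apply: sumr_ge0 => ? _); exact: sqr_ge0.
have -> : \sum_i \sum_j (a i * b j - a j * b i) ^+ 2
    = 2 * ((\sum_i a i ^+ 2) * (\sum_i b i ^+ 2) - (\sum_i a i * b i) ^+ 2).
  have e1 : (\sum_i a i ^+ 2) * (\sum_i b i ^+ 2)
      = \sum_i \sum_j a i ^+ 2 * b j ^+ 2 by rewrite big_distrlr.
  have e2 : (\sum_i a i ^+ 2) * (\sum_i b i ^+ 2)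
      = \sum_i \sum_j a j ^+ 2 * b i ^+ 2 by rewrite e1 exchange_big.
  have e3 : (\sum_i a i * b i) ^+ 2
      = \sum_i \sum_j (a i * b i) * (a j * b j) by rewrite expr2 big_distrlr.
  rewrite mulrBr [2 * (_ * _)]mulr_natl mulr2n {1}e1 e2 e3 mulr_sumr.
  rewrite -!big_split -sumrB; apply: eq_bigr => i _ /=.
  rewrite mulr_sumr -!big_split -sumrB; apply: eq_bigr => j _ /=.
  ring.
by rewrite pmulr_rge0 // subr_ge0.
Qed.

(** For symmetric [B], [|B|_op^4 = |B^2|_op^2 <= |B^2|_F^2]; the proof applies
    Cauchy-Schwarz to [u . B u], to [|B u|^2 = u . B^2 u], and to each row of
    [B^2 u]. *)
Lemma form_le_frobenius_sqr (n : nat) (B : 'I_n -> 'I_n -> R) (c : R)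
    (u : 'I_n -> R) :
  0 <= c -> (forall i k, B i k = B k i) ->
  \sum_i \sum_k (\sum_l B i l * B l k) ^+ 2 <= c ^+ 4 ->
  `|\sum_i u i * \sum_k B i k * u k| <= c * \sum_i u i ^+ 2.
Proof.
move=> c0 symB hF.
set U := \sum_i u i ^+ 2.
have U0 : 0 <= U by apply: sumr_ge0 => i _; exact: sqr_ge0.
set B2 := fun i k => \sum_l B i l * B l k.
pose Bu i := \sum_k B i k * u k.
have BuE : \sum_i Bu i ^+ 2 = \sum_k u k * \sum_l B2 k l * u l.
  transitivity (\sum_i \sum_k \sum_l B i k * u k * (B i l * u l)).
    by apply: eq_bigr => i _; rewrite expr2 big_distrlr.
  rewrite exchange_big; apply: eq_bigr => k _ /=.
  rewrite exchange_big mulr_sumr; apply: eq_bigr => l _ /=.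
  rewrite mulr_suml mulr_sumr; apply: eq_bigr => i _.
  by rewrite (symB i k); ring.
have S2 : (\sum_i Bu i ^+ 2) ^+ 2 <= (U * c ^+ 2) ^+ 2.
  rewrite BuE; apply: le_trans (cauchy_schwarz_sum _ _) _.
  rewrite exprMn -[(c ^+ 2) ^+ 2]exprM -/U expr2 -mulrA ler_wpM2l //.
  have : \sum_i (\sum_l B2 i l * u l) ^+ 2
      <= \sum_i (\sum_l B2 i l ^+ 2) * U.
    by apply: ler_sum => i _; exact: cauchy_schwarz_sum.
  move=> /le_trans; apply; rewrite -mulr_suml mulrC.
  by rewrite ler_wpM2l.
have S1 : \sum_i Bu i ^+ 2 <= U * c ^+ 2.
  move: S2; rewrite ler_pXn2r // nnegrE ?mulr_ge0 ?exprn_ge0 //.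
  by apply: sumr_ge0 => i _; exact: sqr_ge0.
rewrite -(@ler_pXn2r _ 2) // ?nnegrE ?mulr_ge0 //.
rewrite real_normK ?num_real //.
apply: le_trans (cauchy_schwarz_sum _ _) _.
rewrite -/U exprMn [c ^+ 2 * _]mulrC [U ^+ 2]expr2 -mulrA.
by rewrite ler_wpM2l.
Qed.

(** On vectors of zero sum the complete graph with weights [p] has gap [p n];
    the degrees and the centered matrix each cost at most [eps n]. *)
Lemma laplacian_gap (n : nat) (p eps : R) (psi : 'I_n -> 'I_n -> R)
    (u : 'I_n -> R) :
  0 <= p -> 0 <= eps -> well_mixed p eps psi -> \sum_i u i = 0 ->
  (p - 2 * eps) * n%:R * \sum_i u i ^+ 2
    <= - \sum_i u i * \sum_(k | k != i) psi i k * (u k - u i).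
Proof.
move=> p0 e0 [sym _ deg frob] u0.
have symB i k : centered p psi i k = centered p psi k i.
  by rewrite /centered eq_sym sym.
have c0 : 0 <= eps * n%:R by rewrite mulr_ge0.
have := form_le_frobenius_sqr u c0 symB frob.
rewrite ler_norml => /andP[_ hT].
set T := (X in X <= _) in hT.
set U := (X in _ * X <= - _).
have U0 : 0 <= U by apply: sumr_ge0 => i _; exact: sqr_ge0.
have rowE i : \sum_(k | k != i) psi i k * (u k - u i)
    = \sum_k centered p psi i k * u k - p * u i
      - (\sum_(k | k != i) psi i k) * u i.
  have e : \sum_(k | k != i) u k = - u i.
    by move: u0; rewrite (bigD1 i) //= => /eqP; rewrite addrC addr_eq0 => /eqP.
  rewrite [\sum_k centered _ _ _ _ * _](bigD1 i) //= {1}/centered eqxx mul0r.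
  have -> : - (p * u i) = \sum_(k | k != i) p * u k by rewrite -mulr_sumr e mulrN.
  rewrite add0r mulr_suml -big_split -sumrB; apply: eq_bigr => k ki.
  rewrite /centered eq_sym (negbTE ki) /=. ring.
have -> : - \sum_i u i * (\sum_(k | k != i) psi i k * (u k - u i))
    = - T + p * U + \sum_i u i ^+ 2 * \sum_(k | k != i) psi i k.
  rewrite /T /U mulr_sumr -!sumrN -!big_split; apply: eq_bigr => i _.
  rewrite rowE /=; ring.
have hD : (p - eps) * n%:R * U
    <= \sum_i u i ^+ 2 * \sum_(k | k != i) psi i k.
  rewrite /U mulr_sumr; apply: ler_sum => i _.
  by rewrite mulrC ler_wpM2l ?sqr_ge0.
have : 0 <= p * U by rewrite mulr_ge0.
move: hT hD; rewrite -/U !mulrBl -!mulrA; lra.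
Qed.

End SpectralGap.

(** * The velocity field in terms of deviations from the means *)

Definition avg (R : realFieldType) (n : nat) (u : 'I_n -> R) : R :=
  n%:R^-1 * \sum_i u i.

Definition dev (R : realFieldType) (n : nat) (u : 'I_n -> R) (i : 'I_n) : R :=
  u i - avg u.

Definition spread (R : realFieldType) (n : nat) (u : 'I_n -> R) : R :=
  avg (fun i => dev u i ^+ 2).

Section Averages.
Variable R : realFieldType.

Lemma eq_avg n (u v : 'I_n -> R) : u =1 v -> avg u = avg v.
Proof. by move=> uv; rewrite /avg; congr (_ * _); exact: eq_bigr. Qed.

Lemma avgD n (u v : 'I_n -> R) : avg (fun i => u i + v i) = avg u + avg v.
Proof. by rewrite /avg big_split mulrDr. Qed.

Lemma avgZ n (c : R) (u : 'I_n -> R) : avg (fun i => c * u i) = c * avg u.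
Proof. by rewrite /avg -mulr_sumr mulrCA. Qed.

Lemma avgB n (u v : 'I_n -> R) : avg (fun i => u i - v i) = avg u - avg v.
Proof. by rewrite /avg sumrB mulrBr. Qed.

Lemma avg_cst n (c : R) : (0 < n)%N -> avg (fun _ : 'I_n => c) = c.
Proof.
move=> n0; rewrite /avg sumr_const card_ord -[c *+ n]mulr_natl mulKf //.
by rewrite pnatr_eq0 -lt0n.
Qed.

Lemma avg_dev n (u : 'I_n -> R) : (0 < n)%N -> avg (dev u) = 0.
Proof. by move=> n0; rewrite /dev avgB avg_cst // subrr. Qed.

Lemma sum_dev n (u : 'I_n -> R) : (0 < n)%N -> \sum_i dev u i = 0.
Proof.
move=> n0; have /eqP := avg_dev u n0.
rewrite /avg mulf_eq0 invr_eq0 pnatr_eq0 => /orP[/eqP n00|/eqP //].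
by rewrite n00 in n0.
Qed.

Lemma ler_avg n (u v : 'I_n -> R) : (forall i, u i <= v i) -> avg u <= avg v.
Proof.
by move=> uv; rewrite /avg ler_wpM2l ?invr_ge0 //; apply: ler_sum.
Qed.

Lemma avg_ge0 n (u : 'I_n -> R) : (forall i, 0 <= u i) -> 0 <= avg u.
Proof. by move=> uv; rewrite /avg mulr_ge0 ?invr_ge0 ?sumr_ge0. Qed.

Lemma spread_ge0 n (u : 'I_n -> R) : 0 <= spread u.
Proof. by apply: avg_ge0 => i; exact: sqr_ge0. Qed.

Lemma exchange_avg n m (f : 'I_n -> 'I_m -> R) :
  avg (fun i => avg (f i)) = avg (fun j => avg (f^~ j)).
Proof. by rewrite /avg -!mulr_sumr exchange_big mulrCA. Qed.

Lemma sqr_avg_le n (u : 'I_n -> R) : avg u ^+ 2 <= avg (fun i => u i ^+ 2).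
Proof.
have [n0|n0] := posnP n.
  by subst n; rewrite /avg invr0 !mul0r expr0n.
have : 0 <= avg (fun i => dev u i ^+ 2) by exact: spread_ge0.
have -> : avg (fun i => dev u i ^+ 2)
    = avg (fun i => u i ^+ 2 - ((2 * avg u) * u i - avg u ^+ 2)).
  by apply: eq_avg => i; rewrite /dev; ring.
rewrite !avgB avgZ avg_cst // subr_ge0.
by rewrite (_ : 2 * avg u * avg u - avg u ^+ 2 = avg u ^+ 2) //; ring.
Qed.

Lemma sqr_avg_mul_le n (c : R) (a u : 'I_n -> R) : 
  (forall i, `|a i| <= c) -> avg (fun i => a i * u i) ^+ 2
    <= c ^+ 2 * avg (fun i => u i ^+ 2).
Proof.
move=> ac; apply: le_trans (sqr_avg_le _) _.
rewrite -avgZ; apply: ler_avg => i.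
rewrite exprMn ler_wpM2r ?sqr_ge0 // -real_normK ?num_real //.
by rewrite ler_pXn2r // nnegrE // (le_trans _ (ac i)).
Qed.

End Averages.

(** The right-hand side of the system for one group; the equation of the other
    group is obtained by exchanging the roles and transposing [phi]. *)
Definition drift (R : realFieldType) (n m : nat) (psi : 'I_n -> 'I_n -> R)
    (phi : 'I_n -> 'I_m -> R) (x : 'I_n -> R) (y : 'I_m -> R) (i : 'I_n) : R :=
  n%:R^-1 * (\sum_(k | k != i) psi i k * (x k - x i))
  - m%:R^-1 * (\sum_j phi i j * (y j - x i)).

Definition well_balanced (R : realFieldType) (n m : nat) (q del : R)
    (phi : 'I_n -> 'I_m -> R) : Prop :=
  (forall i j, 0 <= phi i j <= 1) /\ (forall i, `|avg (phi i) - q| <= del).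

(** The coupling of the means with the deviations: it would vanish if all the
    row averages of [phi] were equal to [q]. *)
Definition imbalance (R : realFieldType) (n m : nat) (q : R)
    (phi : 'I_n -> 'I_m -> R) (u : 'I_n -> R) : R :=
  avg (fun i => (avg (phi i) - q) * u i).

Lemma well_balanced_avg (R : realFieldType) (n m : nat) (q del : R)
    (phi : 'I_n -> 'I_m -> R) : (0 < n)%N -> well_balanced q del phi ->
  `|avg (fun i => avg (phi i)) - q| <= del.
Proof.
move=> n0 [_ bal].
have -> : avg (fun i => avg (phi i)) - q = avg (fun i => avg (phi i) - q).
  by rewrite avgB avg_cst.
rewrite ler_norml; apply/andP; split.
  rewrite -[- del](@avg_cst _ n) //; apply: ler_avg => k.
  by have := bal k; rewrite ler_norml => /andP[].
rewrite -[del](@avg_cst _ n) //; apply: ler_avg => k.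
by have := bal k; rewrite ler_norml => /andP[].
Qed.

Section Drift.
Variable R : realFieldType.
Variables (n m : nat) (p q eps del : R).
Variables (psi : 'I_n -> 'I_n -> R) (phi : 'I_n -> 'I_m -> R).
Hypotheses (n0 : (0 < n)%N) (m0 : (0 < m)%N).
Hypotheses (p0 : 0 < p) (eps0 : 0 <= eps) (del0 : 0 <= del) (del1 : del <= 1).
Let phiT j i := phi i j.
Hypotheses (wm : well_mixed p eps psi).
Hypotheses (wb : well_balanced q del phi) (wbT : well_balanced q del phiT).
Variables (x : 'I_n -> R) (y : 'I_m -> R).
Let u := dev x.
Let v := dev y.
Let D := avg x - avg y.

Lemma drift_dev i : drift psi phi x y i =
  n%:R^-1 * (\sum_(k | k != i) psi i k * (u k - u i))
  + avg (phi i) * u i - avg (fun j => phi i j * v j) + avg (phi i) * D.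
Proof.
rewrite /drift -/(avg _).
have -> : avg (fun j => phi i j * (y j - x i))
    = avg (fun j => phi i j * v j - (u i + D) * phi i j).
  by apply: eq_avg => j; rewrite /u /v /D /dev; ring.
rewrite avgB avgZ.
have -> : \sum_(k | k != i) psi i k * (x k - x i)
    = \sum_(k | k != i) psi i k * (u k - u i).
  by apply: eq_bigr => k _; rewrite /u /dev; ring.
ring.
Qed.

Lemma imbalance_dev : avg (fun i => avg (phi i) * u i) = imbalance q phi u.
Proof.
rewrite /imbalance.
have -> : avg (fun i => (avg (phi i) - q) * u i)
   = avg (fun i => avg (phi i) * u i - q * u i).
  by apply: eq_avg => i; ring.
by rewrite avgB avgZ avg_dev // mulr0 subr0.
Qed.

Lemma imbalanceT_dev : avg (fun i => avg (fun j => phi i j * v j))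
  = imbalance q phiT v.
Proof.
rewrite exchange_avg /imbalance.
have -> : avg (fun j => (avg (phiT j) - q) * v j)
   = avg (fun j => avg (phiT j) * v j - q * v j).
  by apply: eq_avg => i; ring.
rewrite avgB avgZ avg_dev // mulr0 subr0; apply: eq_avg => j.
by rewrite mulrC -avgZ; apply: eq_avg => i; rewrite mulrC.
Qed.

(** The symmetric interactions inside the group cancel. *)
Lemma avg_drift : avg (drift psi phi x y) =
  avg (fun i => avg (phi i)) * D + imbalance q phi u - imbalance q phiT v.
Proof.
have [sym _ _ _] := wm.
rewrite (eq_avg drift_dev) avgD avgB avgD avgZ imbalance_dev imbalanceT_dev.
have -> : avg (fun i => avg (phi i) * D) = avg (fun i => avg (phi i)) * D.
  by rewrite mulrC -avgZ; apply: eq_avg => i; rewrite mulrC.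
suff -> : avg (fun i => \sum_(k | k != i) psi i k * (u k - u i)) = 0 by ring.
rewrite /avg; set S := \sum_i _; suff -> : S = 0 by rewrite mulr0.
have : S = - S.
  rewrite {1}/S (exchange_big_dep xpredT) //= -sumrN; apply: eq_bigr => k _.
  rewrite -sumrN; apply: eq_big => [i|i _]; first by rewrite eq_sym.
  by rewrite sym; ring.
lra.
Qed.

Lemma sqr_imbalance_le :
  imbalance q phi u ^+ 2 <= del ^+ 2 * spread x.
Proof. by apply: sqr_avg_mul_le; case: wb. Qed.

Lemma avg_row_le i : avg (phi i) <= q + del.
Proof. by have [_ /(_ i)] := wb; rewrite ler_norml => /andP[]; lra. Qed.

Lemma avg_col_le j : avg (phiT j) <= q + del.
Proof. by have [_ /(_ j)] := wbT; rewrite ler_norml => /andP[]; lra. Qed.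

(** The cross terms [- phi i j (u i v j)] are bounded by
    [phi i j (u i ^ 2 + v j ^ 2) / 2], that is by row and column averages. Together
    with the repulsion this makes [spread] grow at rate [4 q] once both groups
    are added, which is affordable because [D ^ 2] grows at the same rate. *)
Lemma energy_drift :
  avg (fun i => u i * drift psi phi x y i) <=
  (- (p - 2 * eps) + 3 / 2 * (q + del)) * spread x
  + (q + del) / 2 * spread y + D * imbalance q phi u.
Proof.
have [[sym _ _ _] [phi01 _]] := (wm, wb).
rewrite (@eq_avg _ _ _ (fun i =>
    n%:R^-1 * (u i * \sum_(k | k != i) psi i k * (u k - u i))
    + avg (phi i) * u i ^+ 2 - avg (fun j => phi i j * (u i * v j))
    + D * (avg (phi i) * u i))); last first.
  move=> i; rewrite drift_dev.
  have -> : avg (fun j => phi i j * (u i * v j))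
      = u i * avg (fun j => phi i j * v j).
    by rewrite -avgZ; apply: eq_avg => j; ring.
  ring.
rewrite avgD avgB avgD avgZ (avgZ n%:R^-1) imbalance_dev.
have h1 : n%:R^-1 * avg (fun i => u i * \sum_(k | k != i) psi i k * (u k - u i))
    <= - (p - 2 * eps) * spread x.
  have := laplacian_gap (ltW p0) eps0 wm (sum_dev x n0).
  have n1 : 0 < n%:R :> R by rewrite ltr0n.
  rewrite -(ler_pM2l n1) -(ler_pM2l n1) => h.
  rewrite -(ler_pM2l n1) -(ler_pM2l n1).
  rewrite /spread /avg -/u; move: h; rewrite -/u.
  set A := \sum_i _; set B := \sum_i _ => h.
  have nz : n%:R != 0 :> R by rewrite gt_eqF.
  rewrite mulVKf // mulVKf // [- _ * _]mulrCA mulVKf //; rewrite !mulrA in h.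
  have : (p - 2 * eps) * n%:R * A <= - B.
    move: h; rewrite -!mulrA ler_pM2l // ler_pM2l //; lra.
  lra.
have h2 : avg (fun i => avg (phi i) * u i ^+ 2) <= (q + del) * spread x.
  rewrite /spread -avgZ; apply: ler_avg => i.
  by rewrite ler_wpM2r ?sqr_ge0 // avg_row_le.
have h3 : avg (fun j => avg (phiT j) * v j ^+ 2) <= (q + del) * spread y.
  rewrite /spread -avgZ; apply: ler_avg => j.
  by rewrite ler_wpM2r ?sqr_ge0 // avg_col_le.
have h4 : - avg (fun i => avg (fun j => phi i j * (u i * v j)))
    <= 1 / 2 * avg (fun i => avg (phi i) * u i ^+ 2)
       + 1 / 2 * avg (fun j => avg (phiT j) * v j ^+ 2).
  have -> : avg (fun j => avg (phiT j) * v j ^+ 2)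
      = avg (fun i => avg (fun j => phi i j * v j ^+ 2)).
    rewrite exchange_avg; apply: eq_avg => j.
    by rewrite mulrC -avgZ; apply: eq_avg => i; rewrite mulrC.
  have -> : avg (fun i => avg (phi i) * u i ^+ 2)
      = avg (fun i => avg (fun j => phi i j * u i ^+ 2)).
    apply: eq_avg => i.
    by rewrite mulrC -avgZ; apply: eq_avg => j; rewrite mulrC.
  rewrite -!avgZ -avgD -mulN1r -avgZ; apply: ler_avg => i.
  rewrite -!avgZ -avgD; apply: ler_avg => j.
  have /andP[f0 _] := phi01 i j.
  have := mulr_ge0 f0 (sqr_ge0 (u i + v j)).
  rewrite sqrrD mulrDr mulrDr mulr2n mulrDr; lra.
lra.
Qed.

Lemma sqr_add4_le (a b c d : R) :
  (a + b + c + d) ^+ 2 <= 4 * (a ^+ 2 + b ^+ 2 + c ^+ 2 + d ^+ 2).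
Proof.
have := sqr_ge0 (a - b); have := sqr_ge0 (a - c); have := sqr_ge0 (a - d).
have := sqr_ge0 (b - c); have := sqr_ge0 (b - d); have := sqr_ge0 (c - d).
rewrite !sqrrB; lra.
Qed.

(** A single deviation is damped by its own degree. The forcing by the other
    agents is a weighted average of deviations, so Jensen's inequality bounds
    its square by the spreads. *)
Lemma dev_drift_le i :
  2 * (u i * (drift psi phi x y i - avg (drift psi phi x y))) <=
  (2 * q - 2 * p + 2 * del + 2 * eps + p / 4) * u i ^+ 2
  + 16 / p * (3 * (spread x + spread y) + 4 * del ^+ 2 * D ^+ 2).
Proof.
have [[sym psi01 deg _] [phi01 bal]] := (wm, wb).
pose a := avg (phi i).
pose r1 := avg (fun k => (if k == i then 0 else psi i k) * u k).
pose r2 := avg (fun j => phi i j * v j).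
pose r3 := (a - avg (fun i => avg (phi i))) * D.
pose r4 := imbalance q phi u - imbalance q phiT v.
have dE : drift psi phi x y i - avg (drift psi phi x y)
    = (a - n%:R^-1 * \sum_(k | k != i) psi i k) * u i + (r1 - r2 + r3 - r4).
  rewrite drift_dev avg_drift.
  have -> : n%:R^-1 * (\sum_(k | k != i) psi i k * (u k - u i))
      = r1 - n%:R^-1 * (\sum_(k | k != i) psi i k) * u i.
    rewrite -mulrA mulr_suml /r1 /avg -mulrBr; congr (_ * _).
    rewrite [\sum_k (if _ then _ else _) * _](bigD1 i) //= eqxx mul0r add0r.
    rewrite -sumrB; apply: eq_bigr => k /negbTE ->; ring.
  rewrite /r2 /r3 /r4 /a; ring.
have b1 : r1 ^+ 2 <= spread x.
  rewrite -[spread x]mul1r -(expr1n _ 2); apply: sqr_avg_mul_le => k.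
  case: ifP => _; first by rewrite normr0.
  by have /andP[? ?] := psi01 i k; rewrite ger0_norm.
have b2 : r2 ^+ 2 <= spread y.
  rewrite -[spread y]mul1r -(expr1n _ 2); apply: sqr_avg_mul_le => j.
  by have /andP[? ?] := phi01 i j; rewrite ger0_norm.
have b3 : r3 ^+ 2 <= 4 * del ^+ 2 * D ^+ 2.
  rewrite exprMn ler_wpM2r ?sqr_ge0 //.
  have -> : 4 * del ^+ 2 = (2 * del) ^+ 2 by ring.
  rewrite -real_normK ?num_real // ler_pXn2r ?nnegrE ?mulr_ge0 //.
  have : `|avg (fun i => avg (phi i)) - q| <= del by exact: well_balanced_avg wb.
  have := bal i; rewrite -/a !ler_norml => /andP[? ?] /andP[? ?].
  by apply/andP; split; lra.
have b4 : r4 ^+ 2 <= 2 * (spread x + spread y).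
  have d1 : del ^+ 2 <= 1 by rewrite -(expr1n _ 2) ler_pXn2r ?nnegrE.
  have e1 : imbalance q phi u ^+ 2 <= spread x.
    by apply: le_trans sqr_imbalance_le _; rewrite ler_piMl // spread_ge0.
  have e2 : imbalance q phiT v ^+ 2 <= spread y.
    apply: (@le_trans _ _ (del ^+ 2 * spread y)).
      by apply: sqr_avg_mul_le; case: wbT.
    by rewrite ler_piMl // spread_ge0.
  have := sqr_ge0 (imbalance q phi u + imbalance q phiT v).
  rewrite /r4 sqrrD sqrrB; lra.
have bR : (r1 - r2 + r3 - r4) ^+ 2 <=
    4 * (3 * (spread x + spread y) + 4 * del ^+ 2 * D ^+ 2).
  have := sqr_add4_le r1 (- r2) r3 (- r4); rewrite !sqrrN; lra.
rewrite dE; set r := r1 - r2 + r3 - r4 in bR *.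
have ha : (a - n%:R^-1 * \sum_(k | k != i) psi i k) <= q + del - p + eps.
  have := avg_row_le i; rewrite -/a.
  have : p - eps <= n%:R^-1 * \sum_(k | k != i) psi i k.
    by rewrite mulrC ler_pdivlMr ?ltr0n.
  lra.
(* Young's inequality spends a quarter of the damping rate [p]. *)
have hr : 2 * (u i * r) <= p / 4 * u i ^+ 2 + 4 / p * r ^+ 2.
  have := mulr_ge0 (ltW (divr_gt0 (ltr0Sn R 3) p0)) (sqr_ge0 (p / 4 * u i - r)).
  rewrite (_ : 4 / p * (_ - _) ^+ 2 = p / 4 * u i ^+ 2 + 4 / p * r ^+ 2 - 2 * (u i * r)).
    by lra.
  by field; rewrite gt_eqF.
have hr2 : 4 / p * r ^+ 2 <=
    16 / p * (3 * (spread x + spread y) + 4 * del ^+ 2 * D ^+ 2).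
  rewrite (_ : 16 / p = 4 / p * 4); last by field; rewrite gt_eqF.
  by rewrite -[4 / p * 4 * _]mulrA ler_wpM2l // divr_ge0 // ltW.
have := ler_wpM2r (sqr_ge0 (u i)) ha.
rewrite mulrDr mulrDr.
rewrite (_ : u i * (_ * u i)
  = (a - n%:R^-1 * \sum_(k | k != i) psi i k) * u i ^+ 2); last by ring.
lra.
Qed.

End Drift.

(** * Differential inequalities for one coordinate *)

Section Barrier.
Variable R : realFieldType.
Variables (p q del : R).
Hypotheses (p0 : 0 < p) (del0 : 0 < del) (delp : del <= p / 16).

(** The inequality [F' <= (4 q - p) F] for [F = V - g D^2], once [V'] and
    [(D^2)'] are replaced by their bounds. The source terms [D E] are absorbed in
    [V] and [D^2]: the part that does not vanish with [g] is compensated by the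
    constant [16 del^2 / p^2] (the lower threshold), and the part quadratic in
    [g] by the smallness of [del^2 g] (the upper threshold). *)
Lemma barrier_ineq (qb V D E g : R) :
  `|qb - q| <= del -> 0 <= V -> E ^+ 2 <= 2 * del ^+ 2 * V ->
  0 <= g -> 128 * del ^+ 2 * g <= p ^+ 2 ->
  (- 2 * p + p / 4 + 4 * q + 4 * del) * V + 2 * (D * E)
    - g * (4 * qb * D ^+ 2 + 4 * (D * E))
    + p / 2 * (g - 16 * del ^+ 2 / p ^+ 2) * D ^+ 2
  <= (4 * q - p) * (V - g * D ^+ 2).
Proof.
move=> hq V0 hE g0 hg.
have pn : p != 0 by rewrite gt_eqF.
have dn : del != 0 by rewrite gt_eqF.
have D0 := sqr_ge0 D.
(* The weight [p / (4 del^2)] makes the [E^2] term worth exactly [p / 2 * V]. *)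
have young : 2 * (D * E) * (1 - 2 * g)
    <= p / (4 * del ^+ 2) * E ^+ 2 + 4 * del ^+ 2 / p * (1 - 2 * g) ^+ 2 * D ^+ 2.
  have h : 0 <= 4 * del ^+ 2 / p by rewrite !mulr_ge0 ?invr_ge0 ?ltW.
  have := mulr_ge0 h (sqr_ge0 (p / (4 * del ^+ 2) * E - (1 - 2 * g) * D)).
  rewrite (_ : 4 * del ^+ 2 / p * (_ - _) ^+ 2 = p / (4 * del ^+ 2) * E ^+ 2
     + 4 * del ^+ 2 / p * (1 - 2 * g) ^+ 2 * D ^+ 2 - 2 * (D * E) * (1 - 2 * g)).
    lra.
  by field; rewrite pn dn.
have hE' : p / (4 * del ^+ 2) * E ^+ 2 <= p / 2 * V.
  have h : 0 <= p / (4 * del ^+ 2).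
    by rewrite divr_ge0 ?(ltW p0) // mulr_ge0 // sqr_ge0.
  apply: le_trans (ler_wpM2l h hE) _.
  by rewrite (_ : _ * (_ * V) = p / 2 * V) //; field; rewrite dn.
have hG : 4 * del ^+ 2 / p * (1 - 2 * g) ^+ 2 <= 4 * del ^+ 2 / p + p / 8 * g.
  have h : 0 <= 4 * del ^+ 2 / p by rewrite !mulr_ge0 ?invr_ge0 ?ltW.
  have h1 : (1 - 2 * g) ^+ 2 <= 1 + 4 * g * g.
    by rewrite sqrrB expr1n expr2; lra.
  apply: le_trans (ler_wpM2l h h1) _.
  have h2 : 16 * del ^+ 2 / p * g <= p / 8.
    rewrite -(ler_pM2l p0) (_ : p * (16 * del ^+ 2 / p * g) = 16 * del ^+ 2 * g).
      by rewrite (_ : p * (p / 8) = p ^+ 2 / 8); [lra|field].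
    by field.
  have := ler_wpM2r g0 h2; lra.
have hG' := ler_wpM2r D0 hG.
have hqb : - (4 * qb * g) + 4 * q * g <= p / 4 * g.
  move: hq; rewrite ler_norml => /andP[h _].
  have : q - qb <= p / 16 by have := delp; lra.
  move=> /(ler_wpM2r g0); lra.
have hqb' := ler_wpM2r D0 hqb.
have hV : (4 * del) * V <= p / 4 * V by rewrite ler_wpM2r //; have := delp; lra.
have -> : p / 2 * (g - 16 * del ^+ 2 / p ^+ 2) * D ^+ 2
   = p / 2 * g * D ^+ 2 - 8 * del ^+ 2 / p * D ^+ 2 by field.
have e : 4 * del ^+ 2 / p * D ^+ 2 <= 8 * del ^+ 2 / p * D ^+ 2.
  have : 0 <= 4 * del ^+ 2 / p * D ^+ 2.
    by rewrite mulr_ge0 // divr_ge0 ?(ltW p0) // mulr_ge0 ?sqr_ge0.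
  lra.
have pg : 0 <= p / 8 * g * D ^+ 2 by rewrite mulr_ge0 // mulr_ge0 // divr_ge0 ?(ltW p0).
have gDE : g * (4 * qb * D ^+ 2 + 4 * (D * E))
  = 4 * qb * g * D ^+ 2 + 4 * (D * E) * g by ring.
rewrite gDE; lra.
Qed.

(** Lower bound for [(D^2)'], leaving a multiple of [V] to be controlled by the
    barrier. *)
Lemma gap_growth_ineq (qb V D E : R) :
  `|qb - q| <= del -> E ^+ 2 <= 2 * del ^+ 2 * V ->
  (4 * q - p / 2) * D ^+ 2 - 32 * del ^+ 2 / p * V
    <= 4 * qb * D ^+ 2 + 4 * (D * E).
Proof.
move=> hq hE; have pn : p != 0 by rewrite gt_eqF.
have D0 := sqr_ge0 D.
have h16 : 0 <= 16 / p by rewrite divr_ge0 // ltW.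
have young : - (4 * (D * E)) <= p / 4 * D ^+ 2 + 16 / p * E ^+ 2.
  have := mulr_ge0 h16 (sqr_ge0 (p / 8 * D + E)).
  rewrite (_ : 16 / p * (_ + _) ^+ 2
    = p / 4 * D ^+ 2 + 16 / p * E ^+ 2 + 4 * (D * E)); first by lra.
  by field.
have hE' := ler_wpM2l h16 hE.
have : (q - qb) * D ^+ 2 <= p / 16 * D ^+ 2.
  by rewrite ler_wpM2r //; move: hq; rewrite ler_norml => /andP[? ?]; have := delp; lra.
lra.
Qed.

End Barrier.

Section CoordinateDynamics.
Variable R : realType.
Variables (n m : nat) (p q del : R).
Variables (psi1 : 'I_n -> 'I_n -> R) (psi2 : 'I_m -> 'I_m -> R).
Variable phi : 'I_n -> 'I_m -> R.
Let phiT j i := phi i j.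
Hypotheses (n0 : (0 < n)%N) (m0 : (0 < m)%N).
Hypotheses (p0 : 0 < p) (p1 : p < 1) (del0 : 0 < del) (delp : del <= p / 16).
Hypotheses (wm1 : well_mixed p (p / 16) psi1) (wm2 : well_mixed p (p / 16) psi2).
Hypotheses (wb : well_balanced q del phi) (wbT : well_balanced q del phiT).
Variables (X : 'I_n -> R -> R) (Y : 'I_m -> R -> R).
Let Xd i t := drift psi1 phi (X^~ t) (Y^~ t) i.
Let Yd j t := drift psi2 phiT (Y^~ t) (X^~ t) j.
Hypotheses (hX : forall i, trajectory (X i) (Xd i)).
Hypotheses (hY : forall j, trajectory (Y j) (Yd j)).
Let qb := avg (fun i => avg (phi i)).
Let D t := avg (X^~ t) - avg (Y^~ t).
Let E t := imbalance q phi (dev (X^~ t)) - imbalance q phiT (dev (Y^~ t)).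
Let V t := spread (X^~ t) + spread (Y^~ t).

Lemma trajectory_avg k (Z Zd : 'I_k -> R -> R) :
  (forall i, trajectory (Z i) (Zd i)) ->
  trajectory (fun t => avg (Z^~ t)) (fun t => avg (Zd^~ t)).
Proof. by move=> hZ; apply: trajectoryZ; exact: trajectory_sum. Qed.

Lemma trajectory_dev k (Z Zd : 'I_k -> R -> R) i :
  (forall i, trajectory (Z i) (Zd i)) ->
  trajectory (fun t => dev (Z^~ t) i) (fun t => Zd i t - avg (Zd^~ t)).
Proof. by move=> hZ; apply: trajectoryB => //; exact: trajectory_avg. Qed.

(** The derivative of the mean drops out because deviations have zero average. *)
Lemma trajectory_spread k (Z Zd : 'I_k -> R -> R) : (0 < k)%N ->
  (forall i, trajectory (Z i) (Zd i)) ->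
  trajectory (fun t => spread (Z^~ t))
    (fun t => 2 * avg (fun i => dev (Z^~ t) i * Zd i t)).
Proof.
move=> k0 hZ.
have := trajectory_avg (fun i => trajectory_sqr (trajectory_dev i hZ)).
apply: eq_trajectory => // t _; rewrite avgZ; congr (_ * _).
rewrite (@eq_avg _ _ _ (fun i => dev (Z^~ t) i * Zd i t
  - avg (Zd^~ t) * dev (Z^~ t) i)); last by move=> i; ring.
by rewrite avgB avgZ avg_dev // mulr0 subr0.
Qed.

Lemma del_le1 : del <= 1. Proof. move: p1 delp; lra. Qed.

Lemma eps_ge0 : 0 <= p / 16. Proof. move: p0; lra. Qed.

Lemma qb_close : `|qb - q| <= del.
Proof. exact: well_balanced_avg. Qed.

Lemma sqr_source_le t : E t ^+ 2 <= 2 * del ^+ 2 * V t.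
Proof.
have h1 := sqr_imbalance_le wb (X^~ t).
have h2 := sqr_imbalance_le wbT (Y^~ t).
have := sqr_ge0 (imbalance q phi (dev (X^~ t)) + imbalance q phiT (dev (Y^~ t))).
rewrite /E /V sqrrD sqrrB; lra.
Qed.

Lemma trajectory_gap : trajectory D (fun t => 2 * qb * D t + 2 * E t).
Proof.
have := trajectoryB (trajectory_avg hX) (trajectory_avg hY).
apply: eq_trajectory => // t _.
rewrite (avg_drift q phi n0 m0 wm1) (avg_drift q phiT m0 n0 wm2).
by rewrite -[avg (fun i => avg (phiT i))]exchange_avg -/qb /D /E; ring.
Qed.

Lemma trajectory_sqr_gap : trajectory (fun t => D t ^+ 2)
  (fun t => 4 * qb * D t ^+ 2 + 4 * (D t * E t)).
Proof.
have := trajectory_sqr trajectory_gap.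
by apply: eq_trajectory => // t _; ring.
Qed.

Definition spread_rate t := 2 * avg (fun i => dev (X^~ t) i * Xd i t)
  + 2 * avg (fun j => dev (Y^~ t) j * Yd j t).

Lemma trajectory_total_spread : trajectory V spread_rate.
Proof. by apply: trajectoryD; exact: trajectory_spread. Qed.

Lemma spread_rate_le t : spread_rate t <=
  (- 2 * p + p / 4 + 4 * q + 4 * del) * V t + 2 * (D t * E t).
Proof.
have := energy_drift n0 p0 eps_ge0 wm1 wb wbT (X^~ t) (Y^~ t).
have := energy_drift m0 p0 eps_ge0 wm2 wbT wb (Y^~ t) (X^~ t).
rewrite /spread_rate /V /D /E /Xd /Yd -/phiT; lra.
Qed.

Lemma spread_sub_gap_rate g t : 0 <= g -> 128 * del ^+ 2 * g <= p ^+ 2 ->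
  spread_rate t - g * (4 * qb * D t ^+ 2 + 4 * (D t * E t))
    + p / 2 * (g - 16 * del ^+ 2 / p ^+ 2) * D t ^+ 2
  <= (4 * q - p) * (V t - g * D t ^+ 2).
Proof.
move=> g0 hg.
have V0 : 0 <= V t by rewrite addr_ge0 ?spread_ge0.
have := barrier_ineq p0 del0 delp (D t) qb_close V0 (sqr_source_le t) g0 hg.
have := spread_rate_le t; lra.
Qed.

Lemma gap_rate t : (4 * q - p / 2) * D t ^+ 2 - 32 * del ^+ 2 / p * V t
    <= 4 * qb * D t ^+ 2 + 4 * (D t * E t).
Proof.
by apply: (gap_growth_ineq p0 delp); [exact: qb_close|exact: sqr_source_le].
Qed.

Lemma sqr_dev_rate i t :
  2 * (dev (X^~ t) i * (Xd i t - avg (Xd^~ t))) <=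
  (2 * q - 3 / 2 * p) * dev (X^~ t) i ^+ 2
  + 16 / p * (3 * V t + 4 * del ^+ 2 * D t ^+ 2).
Proof.
have := dev_drift_le n0 m0 p0 (ltW del0) del_le1 wm1 wb wbT (X^~ t) (Y^~ t) i.
move=> /le_trans; apply; rewrite -/(V t) -/(D t) lerD2r.
by rewrite ler_wpM2r ?sqr_ge0 //; have := delp; lra.
Qed.

End CoordinateDynamics.

(** * Separation for typical interactions *)

(** Variances and gaps are sums over coordinates of their scalar counterparts,
    and the system acts on each coordinate separately. *)
Definition coord (R : Type) (d n : nat) (k : 'I_d) (u : 'I_n -> 'rV[R]_d)
  (i : 'I_n) : R := u i ord0 k.

Section Coordinates.
Variables (R : realType) (d : nat).

Lemma mean_coord n (u : 'I_n -> 'rV[R]_d) k : mean u ord0 k = avg (coord k u).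
Proof. by rewrite /mean !mxE summxE. Qed.

Lemma deviation_coord n (u : 'I_n -> 'rV[R]_d) i k :
  deviation u i ord0 k = dev (coord k u) i.
Proof. by rewrite /dev -mean_coord /deviation mxE; congr (_ + _); rewrite mxE. Qed.

Lemma var_coord n (u : 'I_n -> 'rV[R]_d) : var u = \sum_k spread (coord k u).
Proof.
rewrite /var /spread /avg -mulr_sumr exchange_big; congr (_ * _).
apply: eq_bigr => i _; apply: eq_bigr => k _; congr (_ ^+ 2).
exact: deviation_coord.
Qed.

Lemma sqnorm_ge0 (v : 'rV[R]_d) : 0 <= sqnorm v.
Proof. by apply: sumr_ge0 => k _; exact: sqr_ge0. Qed.

Lemma sqnorm_gt0 (v : 'rV[R]_d) : (0 < sqnorm v) = (v != 0).
Proof.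
rewrite lt_neqAle sqnorm_ge0 andbT eq_sym; congr negb.
apply/idP/eqP => [|->]; last first.
  by rewrite /sqnorm big1 // => k _; rewrite mxE expr0n.
rewrite psumr_eq0 => [/allP h|k _]; last exact: sqr_ge0.
apply/rowP => k; apply/eqP; rewrite mxE -sqrf_eq0.
by have := h k; rewrite mem_index_enum => /(_ isT).
Qed.

Lemma var_ge0 n (u : 'I_n -> 'rV[R]_d) : 0 <= var u.
Proof.
by rewrite mulr_ge0 ?invr_ge0 // sumr_ge0 // => i _; exact: sqnorm_ge0.
Qed.

Lemma max_sqdev_ge0 n (u : 'I_n -> 'rV[R]_d) : 0 <= max_sqdev u.
Proof. exact: bigmax_ge_id. Qed.

Lemma sqnorm_le_max_sqdev n (u : 'I_n -> 'rV[R]_d) i :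
  sqnorm (deviation u i) <= max_sqdev u.
Proof. exact: (le_bigmax _ (fun i => sqnorm (deviation u i))). Qed.

Lemma var_le_max_sqdev n (u : 'I_n -> 'rV[R]_d) : (0 < n)%N ->
  var u <= max_sqdev u.
Proof.
move=> n0; rewrite -[X in _ <= X](@avg_cst _ n) //.
by apply: ler_avg => i; exact: sqnorm_le_max_sqdev.
Qed.

Lemma lambda2_ge0 n m (u : 'I_n -> 'rV[R]_d) (v : 'I_m -> 'rV[R]_d) :
  0 <= lambda2 u v.
Proof. by rewrite /lambda2 divr_ge0 ?sqnorm_ge0 ?addr_ge0 ?var_ge0. Qed.

Lemma lambda_sup_ge0 n m (u : 'I_n -> 'rV[R]_d) (v : 'I_m -> 'rV[R]_d) :
  0 <= lambda_sup u v.
Proof. by rewrite /lambda_sup divr_ge0 ?sqnorm_ge0 ?addr_ge0 ?max_sqdev_ge0. Qed.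

End Coordinates.

Section Separation.
Variables (R : realType) (d n m : nat) (p q del : R).
Variables (psi1 : 'I_n -> 'I_n -> R) (psi2 : 'I_m -> 'I_m -> R).
Variable phi : 'I_n -> 'I_m -> R.
Let phiT j i := phi i j.
Hypotheses (n0 : (0 < n)%N) (m0 : (0 < m)%N).
Hypotheses (p0 : 0 < p) (p1 : p < 1) (q0 : 0 <= q).
Hypotheses (del0 : 0 < del) (delp : del <= p / 16).
Hypotheses (wm1 : well_mixed p (p / 16) psi1) (wm2 : well_mixed p (p / 16) psi2).
Hypotheses (wb : well_balanced q del phi) (wbT : well_balanced q del phiT).
Variables (x : 'I_n -> R -> 'rV[R]_d) (y : 'I_m -> R -> 'rV[R]_d).
Hypothesis sol : solution psi1 psi2 phi x y.

Let lm := 16 * del ^+ 2 / p ^+ 2.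
Let X k i t := coord k (x^~ t) i.
Let Y k j t := coord k (y^~ t) j.
Let Xd k i t := drift psi1 phi (X k ^~ t) (Y k ^~ t) i.
Let Yd k j t := drift psi2 phiT (Y k ^~ t) (X k ^~ t) j.
Let V t := var (x^~ t) + var (y^~ t).
Let S t := sqnorm (mean (x^~ t) - mean (y^~ t)).
Let D k t := avg (X k ^~ t) - avg (Y k ^~ t).
Let Sd t := \sum_k (4 * avg (fun i => avg (phi i)) * D k t ^+ 2
  + 4 * (D k t * (imbalance q phi (dev (X k ^~ t))
                  - imbalance q phiT (dev (Y k ^~ t))))).
Let Vd t := \sum_k spread_rate psi1 psi2 phi (X k) (Y k) t.

Lemma trajectory_x k i : trajectory (X k i) (Xd k i).
Proof.
have [cx _ dx _] := sol.
have := trajectory_coord k (cx i) (dx i).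
apply: eq_trajectory => // t _.
rewrite /Xd /drift !mxE !summxE; congr (_ * _ - _ * _).
  by apply: eq_bigr => i' _; rewrite !mxE.
by apply: eq_bigr => i' _; rewrite !mxE.
Qed.

Lemma trajectory_y k j : trajectory (Y k j) (Yd k j).
Proof.
have [_ cy _ dy] := sol.
have := trajectory_coord k (cy j) (dy j).
apply: eq_trajectory => // t _.
rewrite /Yd /drift !mxE !summxE; congr (_ * _ - _ * _).
  by apply: eq_bigr => i' _; rewrite !mxE.
by apply: eq_bigr => i' _; rewrite !mxE.
Qed.

Lemma gapE t : S t = \sum_k D k t ^+ 2.
Proof.
apply: eq_bigr => k _; rewrite /D -!mean_coord mxE; congr ((_ + _) ^+ 2).
by rewrite mxE.
Qed.

Lemma varE t : V t = \sum_k (spread (X k ^~ t) + spread (Y k ^~ t)).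
Proof. by rewrite /V !var_coord -big_split. Qed.

Lemma trajectory_S : trajectory S Sd.
Proof.
have h k := trajectory_sqr_gap q n0 m0 wm1 wm2 (trajectory_x k) (trajectory_y k).
have := trajectory_sum (index_enum 'I_d) h.
by apply: eq_trajectory => // t; rewrite gapE.
Qed.

Lemma trajectory_V : trajectory V Vd.
Proof.
have h k := trajectory_total_spread n0 m0 (trajectory_x k) (trajectory_y k).
have := trajectory_sum (index_enum 'I_d) h.
by apply: eq_trajectory => // t; rewrite varE.
Qed.

Lemma lm_gt0 : 0 < lm.
Proof. by rewrite /lm divr_gt0 ?mulr_gt0 ?exprn_gt0. Qed.

Lemma total_spread_sub_gap_rate g t : 0 <= g -> 128 * del ^+ 2 * g <= p ^+ 2 ->
  Vd t - g * Sd t + p / 2 * (g - lm) * S t <= (4 * q - p) * (V t - g * S t).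
Proof.
move=> g0 hg; rewrite gapE varE /Vd /Sd !mulr_sumr -!sumrB mulr_sumr.
rewrite -big_split; apply: ler_sum => k _.
exact: (spread_sub_gap_rate n0 m0 p0 del0 delp wm1 wm2 wb wbT _ _ _ g0 hg).
Qed.

Lemma total_gap_rate t :
  (4 * q - p / 2) * S t - 32 * del ^+ 2 / p * V t <= Sd t.
Proof.
rewrite gapE varE /Sd !mulr_sumr -!sumrB; apply: ler_sum => k _.
exact: (gap_rate n0 p0 delp wb wbT).
Qed.

Hypothesis sep0 : mean (x^~ 0) != mean (y^~ 0).
Hypothesis lam0 : 128 * del ^+ 2 * lambda2 (x^~ 0) (y^~ 0) <= p ^+ 2.

Let l0 := lambda2 (x^~ 0) (y^~ 0).
Let g t := lm + (l0 - lm) * expR (- (p / 2) * t).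

Lemma S0_gt0 : 0 < S 0.
Proof. by rewrite sqnorm_gt0 subr_eq0. Qed.

Lemma expR_decay_le1 t : 0 <= t -> expR (- (p / 2) * t) <= 1.
Proof.
move=> t0; rewrite -[X in _ <= X]expR0 ler_expR mulNr oppr_le0.
by rewrite mulr_ge0 // divr_ge0 // ltW.
Qed.

Lemma g_ge0 t : 0 <= t -> 0 <= g t.
Proof.
move=> t0; rewrite /g.
have -> : lm + (l0 - lm) * expR (- (p / 2) * t)
  = lm * (1 - expR (- (p / 2) * t)) + l0 * expR (- (p / 2) * t) by ring.
rewrite addr_ge0 // mulr_ge0 ?expR_ge0 ?lambda2_ge0 ?(ltW lm_gt0) //.
by rewrite subr_ge0 expR_decay_le1.
Qed.

(** [g t] is a convex combination of [lm] and [l0], both below the upper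
    threshold. *)
Lemma g_bound t : 0 <= t -> 128 * del ^+ 2 * g t <= p ^+ 2.
Proof.
move=> t0; rewrite /g.
have -> : 128 * del ^+ 2 * (lm + (l0 - lm) * expR (- (p / 2) * t))
  = 128 * del ^+ 2 * lm * (1 - expR (- (p / 2) * t))
    + 128 * del ^+ 2 * l0 * expR (- (p / 2) * t) by ring.
have h : 128 * del ^+ 2 * lm <= p ^+ 2.
  have d0 := ltW del0.
  have e2 : (16 * del) ^+ 2 <= p ^+ 2.
    by rewrite ler_pXn2r ?nnegrE ?mulr_ge0 ?(ltW p0) //; have := delp; lra.
  have lm1 : lm <= 1.
    rewrite /lm ler_pdivrMr ?exprn_gt0 // mul1r.
    by have := sqr_ge0 del; lra.
  have h128 : 0 <= 128 * del ^+ 2 by rewrite mulr_ge0 ?sqr_ge0.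
  have := ler_wpM2l h128 lm1; have := sqr_ge0 del; lra.
have h1 : 0 <= 1 - expR (- (p / 2) * t) by rewrite subr_ge0 expR_decay_le1.
have := ler_wpM2r h1 h; have := ler_wpM2r (expR_ge0 (- (p / 2) * t)) lam0.
rewrite -/l0; lra.
Qed.

Lemma trajectory_g : trajectory g (fun t => - (p / 2) * (g t - lm)).
Proof.
have := trajectoryD (trajectory_cst lm)
          (trajectoryZ (l0 - lm) (trajectory_expR (- (p / 2)))).
by apply: eq_trajectory => // t _; rewrite /g add0r; ring.
Qed.

(** The barrier: equality holds at time [0] by definition of [lambda2]. *)
Lemma spread_le_gap t : 0 <= t -> V t <= g t * S t.
Proof.
move=> t0; rewrite -subr_le0; move: t t0.
apply: (@gronwall_le0 _ (4 * q - p) (fun t => V t - g t * S t)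
  (fun t => Vd t - (- (p / 2) * (g t - lm) * S t + g t * Sd t))).
- exact: trajectoryB trajectory_V (trajectoryM trajectory_g trajectory_S).
- move=> t /ltW t0.
  have := total_spread_sub_gap_rate t (g_ge0 t0) (g_bound t0).
  lra.
- rewrite /g mulr0 expR0 mulr1 [lm + _]addrC subrK /l0 /lambda2 -/(V 0) -/(S 0).
  by rewrite divfK ?subrr // gt_eqF // S0_gt0.
Qed.

(** Below the upper threshold the source term costs at most [p / 4] of the growth
    rate of the gap. *)
Lemma gap_rate_ge t : 0 <= t -> (4 * q - 3 / 4 * p) * S t <= Sd t.
Proof.
move=> t0; have := total_gap_rate t.
have h0 : 0 <= 32 * del ^+ 2 / p.
  by rewrite divr_ge0 ?(ltW p0) // mulr_ge0 ?sqr_ge0.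
have := ler_wpM2l h0 (spread_le_gap t0).
have h1 : 32 * del ^+ 2 / p * g t <= p / 4.
  rewrite -(@ler_pM2r _ p) // (_ : _ * p = 32 * del ^+ 2 * g t).
    by have := g_bound t0; lra.
  by field; rewrite gt_eqF.
have := ler_wpM2r (sqnorm_ge0 (mean (x^~ t) - mean (y^~ t))) h1.
rewrite -/(S t); lra.
Qed.

(** Comparison with the exponential of the growth rate, so that the two means
    never meet. *)
Lemma gap_gt0 t : 0 <= t -> 0 < S t.
Proof.
move=> t0; apply: (@lt_le_trans _ _ (S 0 * expR ((4 * q - 3 / 4 * p) * t))).
  by rewrite mulr_gt0 ?expR_gt0 ?S0_gt0.
rewrite -subr_le0; move: t t0.
apply: (@gronwall_le0 _ (4 * q - 3 / 4 * p)
  (fun t => S 0 * expR ((4 * q - 3 / 4 * p) * t) - S t)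
  (fun t => S 0 * ((4 * q - 3 / 4 * p) * expR ((4 * q - 3 / 4 * p) * t)) - Sd t)).
- exact: trajectoryB (trajectoryZ _ (trajectory_expR _)) trajectory_S.
- by move=> t /ltW /gap_rate_ge; lra.
- by rewrite mulr0 expR0 mulr1 subrr.
Qed.

Lemma mean_separated t : 0 <= t -> mean (x^~ t) != mean (y^~ t).
Proof. by move=> /gap_gt0; rewrite sqnorm_gt0 subr_eq0. Qed.

Lemma lambda2_decay t : 0 <= t ->
  lambda2 (x^~ t) (y^~ t) <= lm + (l0 - lm) * expR (- (p / 2) * t).
Proof.
move=> t0; rewrite /lambda2 -/(V t) -/(S t) ler_pdivrMr ?gap_gt0 //.
exact: spread_le_gap.
Qed.

Let lt0 := lambda_sup (x^~ 0) (y^~ 0).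
Let h t := lm + lt0 * expR (- (p / 2) * t).

Lemma g_le_h t : g t <= h t.
Proof.
rewrite /g /h lerD2l ler_wpM2r ?expR_ge0 //.
have : l0 <= lt0.
  rewrite /l0 /lt0 /lambda2 /lambda_sup ler_wpM2r ?invr_ge0 ?sqnorm_ge0 //.
  by rewrite lerD // var_le_max_sqdev.
by have := lm_gt0; lra.
Qed.

Lemma trajectory_h : trajectory h (fun t => - (p / 2) * (h t - lm)).
Proof.
have := trajectoryD (trajectory_cst lm)
          (trajectoryZ lt0 (trajectory_expR (- (p / 2)))).
by apply: eq_trajectory => // t _; rewrite /h add0r; ring.
Qed.

Lemma h_ge0 t : 0 <= h t.
Proof. by rewrite addr_ge0 ?(ltW lm_gt0) // mulr_ge0 ?expR_ge0 ?lambda_sup_ge0. Qed.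

(** The barrier argument for any quantity damped like a single squared
    deviation, [V] being already controlled by [g S <= h S]. The constant [208 / p^2]
    is chosen so that its share [p / 4] of the decay balances the forcing
    [52 / p * h S]. *)
Lemma sqnorm_deviation_le (f f' : R -> R) :
  trajectory f f' ->
  (forall t, f' t <= (2 * q - 3 / 2 * p) * f t
     + 16 / p * (3 * V t + 4 * del ^+ 2 * S t)) ->
  (forall t, 0 <= f t) -> f 0 <= lt0 * S 0 ->
  forall t, 0 <= t -> f t <= 208 / p ^+ 2 * h t * S t.
Proof.
move=> hf hf' fge0 f0 t t0; rewrite -subr_le0; move: t t0.
have pn : p != 0 by rewrite gt_eqF.
apply: (@gronwall_le0 _ (4 * q - 3 / 2 * p)
  (fun t => f t - 208 / p ^+ 2 * h t * S t)
  (fun t => f' t - (208 / p ^+ 2 * (- (p / 2) * (h t - lm)) * S t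
                    + 208 / p ^+ 2 * h t * Sd t))).
- exact: trajectoryB hf (trajectoryM (trajectoryZ _ trajectory_h) trajectory_S).
- move=> t /ltW t0.
  have S0 : 0 <= S t := sqnorm_ge0 _.
  have K0 : 0 <= 208 / p ^+ 2 by rewrite divr_ge0 ?sqr_ge0.
  have hV : V t <= h t * S t.
    by apply: le_trans (spread_le_gap t0) _; rewrite ler_wpM2r // g_le_h.
  have hlm : lm <= h t.
    by rewrite /h lerDl mulr_ge0 ?expR_ge0 ?lambda_sup_ge0.
  have hS : 4 * del ^+ 2 * S t <= 1 / 4 * (h t * S t).
    rewrite [1 / 4 * _]mulrA ler_wpM2r //.
    have p21 : p ^+ 2 <= 1 by rewrite expr_le1 ?(ltW p0) ?(ltW p1).
    have : p ^+ 2 * lm <= 1 * h t.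
      by rewrite ler_pM ?sqr_ge0 ?(ltW lm_gt0).
    rewrite (_ : p ^+ 2 * lm = 16 * del ^+ 2); first by lra.
    by rewrite /lm; field.
  (* [13 / 4 = 3 + 1 / 4] collects [3 V] and [4 del^2 S]. *)
  have hsrc : 16 / p * (3 * V t + 4 * del ^+ 2 * S t)
      <= 208 / p ^+ 2 * (p / 4) * (h t * S t).
    rewrite (_ : 208 / p ^+ 2 * (p / 4) = 16 / p * (13 / 4)); last by field.
    rewrite -[16 / p * (13 / 4) * _]mulrA ler_wpM2l //; first by rewrite divr_ge0 // ltW.
    lra.
  have hgap := ler_wpM2l (mulr_ge0 K0 (h_ge0 t)) (gap_rate_ge t0).
  have hlmS : 0 <= 208 / p ^+ 2 * (p / 2) * lm * S t.
    rewrite mulr_ge0 // mulr_ge0 ?(ltW lm_gt0) // mulr_ge0 //.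
    by rewrite divr_ge0 // ltW.
  have qf : (2 * q - 3 / 2 * p) * f t <= (4 * q - 3 / 2 * p) * f t.
    by rewrite ler_wpM2r //; have := q0; lra.
  have := hf' t; lra.
- rewrite subr_le0 /h mulr0 expR0 mulr1.
  apply: le_trans f0 _; rewrite ler_wpM2r ?sqnorm_ge0 //.
  have K1 : 1 <= 208 / p ^+ 2.
    rewrite ler_pdivlMr ?exprn_gt0 // mul1r.
    apply: (@le_trans _ _ 1) => //; last by rewrite ler1n.
    by rewrite expr_le1 ?(ltW p0) ?(ltW p1).
  have l0' : 0 <= lm + lt0 by rewrite addr_ge0 ?(ltW lm_gt0) ?lambda_sup_ge0.
  have := ler_wpM2r l0' K1; rewrite mul1r; apply: le_trans.
  by rewrite lerDr ltW // lm_gt0.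
Qed.

Lemma max_sqdev_le_sup0 n' (u : 'I_n' -> 'rV[R]_d) i (c : R) :
  0 <= c -> max_sqdev u + c <= lt0 * S 0 -> sqnorm (deviation u i) <= lt0 * S 0.
Proof.
move=> c0; apply: le_trans; rewrite -[X in X <= _]addr0.
by rewrite lerD // sqnorm_le_max_sqdev.
Qed.

Lemma sup0E : max_sqdev (x^~ 0) + max_sqdev (y^~ 0) = lt0 * S 0.
Proof. by rewrite /lt0 /lambda_sup -/(S 0) divfK // gt_eqF // S0_gt0. Qed.

Lemma sqnorm_deviation_x_le i t : 0 <= t ->
  sqnorm (deviation (x^~ t) i) <= 208 / p ^+ 2 * h t * S t.
Proof.
have devE s : sqnorm (deviation (x^~ s) i) = \sum_k dev (X k ^~ s) i ^+ 2.
  by apply: eq_bigr => k _; rewrite deviation_coord.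
have hdev k := trajectory_sqr (trajectory_dev i (trajectory_x k)).
move: t; apply: sqnorm_deviation_le.
- have := trajectory_sum (index_enum 'I_d) hdev.
  by apply: eq_trajectory; [by move=> s; rewrite devE|move=> s _; exact: erefl].
- move=> t; rewrite devE varE gapE !mulr_sumr -big_split !mulr_sumr -big_split.
  apply: ler_sum => k _.
  exact: (sqr_dev_rate n0 m0 p0 p1 del0 delp wm1 wb wbT (X k) (Y k) i t).
- by move=> t; exact: sqnorm_ge0.
- apply: (@max_sqdev_le_sup0 _ _ _ (max_sqdev (y^~ 0))).
    exact: max_sqdev_ge0.
  by rewrite sup0E.
Qed.

Lemma sqnorm_deviation_y_le j t : 0 <= t ->
  sqnorm (deviation (y^~ t) j) <= 208 / p ^+ 2 * h t * S t.
Proof.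
have devE s : sqnorm (deviation (y^~ s) j) = \sum_k dev (Y k ^~ s) j ^+ 2.
  by apply: eq_bigr => k _; rewrite deviation_coord.
have hdev k := trajectory_sqr (trajectory_dev j (trajectory_y k)).
move: t; apply: sqnorm_deviation_le.
- have := trajectory_sum (index_enum 'I_d) hdev.
  by apply: eq_trajectory; [by move=> s; rewrite devE|move=> s _; exact: erefl].
- move=> t; rewrite devE varE gapE !mulr_sumr -big_split !mulr_sumr -big_split.
  apply: ler_sum => k _.
  have := sqr_dev_rate m0 n0 p0 p1 del0 delp wm2 wbT wb (Y k) (X k) j t.
  by rewrite [spread (Y k ^~ t) + _]addrC -[_ - avg (X k ^~ t)]opprB sqrrN.
- by move=> t; exact: sqnorm_ge0.
- apply: (@max_sqdev_le_sup0 _ _ _ (max_sqdev (x^~ 0))).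
    exact: max_sqdev_ge0.
  by rewrite addrC sup0E.
Qed.

Lemma lambda_sup_decay t : 0 <= t ->
  lambda_sup (x^~ t) (y^~ t)
    <= 416 / p ^+ 2 * (lm + lt0 * expR (- (p / 2) * t)).
Proof.
move=> t0; rewrite /lambda_sup -/(S t) ler_pdivrMr ?gap_gt0 // -/(h t).
have K0 : 0 <= 208 / p ^+ 2 * h t * S t.
  by rewrite mulr_ge0 ?sqnorm_ge0 // mulr_ge0 ?h_ge0 // divr_ge0 ?sqr_ge0.
have hx : max_sqdev (x^~ t) <= 208 / p ^+ 2 * h t * S t.
  by apply/bigmax_leP; split=> // i _; exact: sqnorm_deviation_x_le.
have hy : max_sqdev (y^~ t) <= 208 / p ^+ 2 * h t * S t.
  by apply/bigmax_leP; split=> // j _; exact: sqnorm_deviation_y_le.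
lra.
Qed.

End Separation.

(** * Products of Bernoulli measures *)

Definition weight (R : realType) (I : finType) (r : I -> R)
    (s : {ffun I -> bool}) : R :=
  \prod_e (if s e then r e else 1 - r e).

Definition expect (R : realType) (I : finType) (r : I -> R)
    (f : {ffun I -> bool} -> R) : R :=
  \sum_s weight r s * f s.

(** From [exp u <= 1 / (1 - u) <= 1 + u + 2 u^2] for [|u| <= 1/2]; the linear terms
    cancel on average. *)
Lemma mgf_bernoulli_le (R : realType) (r s : R) : 0 <= r <= 1 -> `|s| <= 1 / 2 ->
  r * expR (s * (1 - r)) + (1 - r) * expR (s * (0 - r)) <= expR (2 * s ^+ 2).
Proof.
move=> /andP[r0 r1] hs.
have hexp (u : R) : `|u| <= 1 / 2 -> expR u <= 1 + u + 2 * u ^+ 2.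
  rewrite ler_norml => /andP[u1 u2].
  have h1 : 0 < 1 - u by lra.
  have : expR u * (1 - u) <= 1.
    rewrite -[X in _ <= X](expRxMexpNx_1 u) ler_wpM2l ?expR_ge0 //.
    exact: expR_ge1Dx.
  rewrite -ler_pdivlMr // => /le_trans; apply.
  rewrite ler_pdivrMr // -subr_ge0.
  rewrite (_ : _ - 1 = u ^+ 2 * (1 - 2 * u)); last by ring.
  by rewrite mulr_ge0 ?sqr_ge0 //; lra.
have hu (a : R) : `|a| <= 1 -> expR (s * a) <= 1 + s * a + 2 * s ^+ 2 * a ^+ 2.
  move=> ha; rewrite -mulrA -exprMn; apply: hexp.
  by rewrite normrM -[X in _ <= X]mulr1 ler_pM.
have a1 : `|1 - r| <= 1 by rewrite ler_norml; apply/andP; split; lra.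
have a2 : `|0 - r| <= 1 by rewrite ler_norml; apply/andP; split; lra.
have r1' : 0 <= 1 - r by lra.
have := ler_wpM2l r0 (hu _ a1); have := ler_wpM2l r1' (hu _ a2).
have : r * (1 - r) * (2 * s ^+ 2) <= 1 * (2 * s ^+ 2).
  have h : r * (1 - r) <= 1 by have := sqr_ge0 r; lra.
  by rewrite ler_wpM2r // mulr_ge0 // sqr_ge0.
have := expR_ge1Dx (2 * s ^+ 2); lra.
Qed.

Section BernoulliProduct.
Variables (R : realType) (I : finType) (r : I -> R).
Hypothesis r01 : forall e, 0 <= r e <= 1.
Implicit Types (s : {ffun I -> bool}).

Lemma weight_ge0 s : 0 <= weight r s.
Proof.
apply: prodr_ge0 => e _; have /andP[? ?] := r01 e.
by case: ifP; rewrite ?subr_ge0.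
Qed.

Lemma expect_prod (F : I -> bool -> R) :
  expect r (fun s => \prod_e F e (s e))
    = \prod_e (r e * F e true + (1 - r e) * F e false).
Proof.
transitivity (\prod_e \sum_b (if b then r e else 1 - r e) * F e b).
  rewrite bigA_distr_bigA; apply: eq_bigr => s _.
  by rewrite /weight -big_split.
by apply: eq_bigr => e _; rewrite big_bool.
Qed.

Lemma expect_cst (c : R) : expect r (fun=> c) = c.
Proof.
rewrite /expect -mulr_suml -[X in X * _](_ : 1 = _) ?mul1r //.
have := expect_prod (fun _ _ => 1).
rewrite [RHS]big1 => [<-|e _]; last by rewrite !mulr1 addrC subrK.
by apply: eq_bigr => s _; rewrite big1 ?mulr1.
Qed.

Lemma ler_expect f g : (forall s, f s <= g s) -> expect r f <= expect r g.
Proof.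
by move=> fg; apply: ler_sum => s _; rewrite ler_wpM2l ?weight_ge0.
Qed.

Lemma eq_expect f g : f =1 g -> expect r f = expect r g.
Proof. by move=> fg; apply: eq_bigr => s _; rewrite fg. Qed.

Lemma expectZ (c : R) f : expect r (fun s => c * f s) = c * expect r f.
Proof. by rewrite /expect mulr_sumr; apply: eq_bigr => s _; rewrite mulrCA. Qed.

Lemma expect_sum (J : Type) (t : seq J) (f : J -> {ffun I -> bool} -> R) :
  expect r (fun s => \sum_(j <- t) f j s) = \sum_(j <- t) expect r (f j).
Proof.
rewrite /expect exchange_big; apply: eq_bigr => s _.
by rewrite mulr_sumr.
Qed.

(** Summing over the two values of the coordinate [e] first; the two halves of
    the sum are matched by flipping that coordinate. *)
Lemma expect_centered_mul (e : I) (g : {ffun I -> bool} -> R) :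
  (forall s s', (forall e', e' != e -> s e' = s' e') -> g s = g s') ->
  expect r (fun s => ((s e)%:R - r e) * g s) = 0.
Proof.
move=> hg.
pose flip s : {ffun I -> bool} := [ffun e' => if e' == e then ~~ s e' else s e'].
have flipK : involutive flip.
  by move=> s; apply/ffunP => e'; rewrite !ffunE; case: eqP; rewrite ?negbK.
pose rest s := \prod_(e' | e' != e) (if s e' then r e' else 1 - r e').
have wE s : weight r s = (if s e then r e else 1 - r e) * rest s.
  by rewrite /weight (bigD1 e).
have restE s : rest (flip s) = rest s.
  by apply: eq_bigr => e' ne; rewrite ffunE (negbTE ne).
have gE s : g (flip s) = g s.
  by apply: hg => e' ne; rewrite ffunE (negbTE ne).
rewrite /expect (bigID (fun s => s e)) /=.
rewrite [X in _ + X](reindex_inj (inv_inj flipK)) /=.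
under [X in _ + X]eq_bigl do rewrite ffunE eqxx negbK.
rewrite -big_split big1 // => s se /=.
by rewrite !wE restE gE ffunE eqxx se /=; ring.
Qed.

(** The family is indexed by an injection so that distinct summands read
    distinct, hence independent, coordinates. *)
Lemma expect_expR_sum_le (J : finType) (P : pred J) (h : J -> I) (c : R) :
  {in P &, injective h} -> `|c| <= 1 / 2 ->
  expect r (fun s => expR (c * \sum_(j | P j) ((s (h j))%:R - r (h j))))
    <= expR (2 * c ^+ 2 * #|J|%:R).
Proof.
move=> hinj hc.
pose A := [set h j | j in P]%SET.
pose F e (b : bool) := if e \in A then expR (c * (b%:R - r e)) else 1.
rewrite (@eq_expect _ (fun s => \prod_e F e (s e))); last first.
  move=> s; rewrite mulr_sumr expR_sum.
  rewrite /F -big_mkcond /= /A big_imset //=.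
rewrite expect_prod.
rewrite (_ : \prod_e _ = \prod_(e in A)
   (r e * expR (c * (1 - r e)) + (1 - r e) * expR (c * (0 - r e)))); last first.
  rewrite [RHS]big_mkcond; apply: eq_bigr => e _; rewrite /F.
  by case: ifP => // _; rewrite !mulr1 addrC subrK.
apply: (@le_trans _ _ (\prod_(e in A) expR (2 * c ^+ 2))).
  apply: ler_prod => e _; apply/andP; split; last exact: mgf_bernoulli_le.
  have /andP[? ?] := r01 e.
  by rewrite addr_ge0 // mulr_ge0 ?expR_ge0 ?subr_ge0.
have c2 : 0 <= 2 * c ^+ 2 by rewrite mulr_ge0 ?sqr_ge0.
rewrite prodr_const -expRM_natr ler_expR ler_wpM2l // ler_nat.
apply: leq_trans (leq_imset_card _ _) _; exact: max_card.
Qed.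

End BernoulliProduct.

(** [c i k] is the coordinate carrying the edge between [i] and [k]; the
    injectivity hypothesis is that of unordered pairs. *)
Section FourthMoment.
Variables (R : realType) (I : finType) (r : I -> R).
Hypothesis r01 : forall e, 0 <= r e <= 1.
Variables (n : nat) (p : R) (c : 'I_n -> 'I_n -> I).
Hypothesis rc : forall i k, i != k -> r (c i k) = p.
Hypothesis c_inj : forall i k j l, i != k -> j != l -> c i k = c j l ->
  (i = j /\ k = l) \/ (i = l /\ k = j).
Let B (s : {ffun I -> bool}) := centered p (fun i k => (s (c i k))%:R).

Lemma centered_norm_le1 s i k : `|B s i k| <= 1.
Proof.
rewrite /B /centered; case: eqVneq => [_|ik]; first by rewrite normr0.
have /andP[] := r01 (c i k); rewrite rc //= => h1 h2.
by rewrite ler_norml; case: (s _); apply/andP; split => /=; lra.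
Qed.

(** The four edges form a closed walk [i l j k]; it degenerates to a loop, where
    the centered matrix vanishes, or its edge [il] occurs exactly once. *)
Lemma expect_centered4 i j k l : i != j -> k != l ->
  expect r (fun s => B s i l * B s l j * (B s i k * B s k j)) = 0.
Proof.
move=> ij kl.
have [li|il] := eqVneq i l.
  rewrite (@eq_expect _ _ r _ (fun=> 0)) ?expect_cst // => s.
  by rewrite /B /centered li eqxx !mul0r.
have [lj|jl] := eqVneq l j.
  rewrite (@eq_expect _ _ r _ (fun=> 0)) ?expect_cst // => s.
  by rewrite /B /centered -lj eqxx mulr0 mul0r.
have [ki|ik] := eqVneq i k.
  rewrite (@eq_expect _ _ r _ (fun=> 0)) ?expect_cst // => s.
  by rewrite /B /centered -ki eqxx mul0r mulr0.
have [kj|jk] := eqVneq k j.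
  rewrite (@eq_expect _ _ r _ (fun=> 0)) ?expect_cst // => s.
  by rewrite /B /centered -kj eqxx !mulr0.
rewrite (@eq_expect _ _ r _ (fun s => ((s (c i l))%:R - r (c i l)) *
    (B s l j * (B s i k * B s k j)))); last first.
  by move=> s; rewrite -mulrA {1}/B {1}/centered (negbTE il) rc.
apply: expect_centered_mul => s s' ss.
have e1 : c l j != c i l.
  apply/eqP => /c_inj -/(_ jl il) [[/esym /eqP]|[_ /eqP]].
    by rewrite (negbTE il).
  by rewrite eq_sym (negbTE ij).
have e2 : c i k != c i l.
  apply/eqP => /c_inj -/(_ ik il) [[_ /eqP]|[/eqP]].
    by rewrite (negbTE kl).
  by rewrite (negbTE il).
have e3 : c k j != c i l.
  apply/eqP => /c_inj -/(_ jk il) [[/esym /eqP]|[/eqP]].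
    by rewrite (negbTE ik).
  by rewrite (negbTE kl).
rewrite /B /centered (negbTE jl) (negbTE ik) (negbTE jk).
by rewrite !ss.
Qed.

(** On the diagonal the trivial bound [n^2] is used for [n] entries; off the
    diagonal only the [n] terms with [k = l] survive. *)
Lemma expect_frobenius_le :
  expect r (fun s => \sum_i \sum_j (\sum_l B s i l * B s l j) ^+ 2)
    <= 2 * n%:R ^+ 3.
Proof.
have term1 s i j l k : B s i l * B s l j * (B s i k * B s k j) <= 1.
  apply: le_trans (ler_norm _) _; rewrite !normrM.
  by rewrite !mulr_ile1 ?mulr_ge0 ?centered_norm_le1.
have sqE s i j : (\sum_l B s i l * B s l j) ^+ 2
    = \sum_l \sum_k B s i l * B s l j * (B s i k * B s k j).
  by rewrite expr2 big_distrlr.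
have sum_cst (a : R) : \sum_(i < n) a = n%:R * a.
  by rewrite sumr_const card_ord mulr_natl.
have entry i j : expect r (fun s => (\sum_l B s i l * B s l j) ^+ 2)
    <= (if i == j then n%:R ^+ 2 else n%:R).
  case: eqVneq => [_|ij].
    rewrite -(expect_cst r (n%:R ^+ 2)); apply: ler_expect => // s.
    rewrite sqE expr2 -[X in _ * X]mulr1 -!sum_cst.
    by apply: ler_sum => l _; apply: ler_sum => k _.
  rewrite (@eq_expect _ _ r _ (fun s => \sum_l \sum_k
     B s i l * B s l j * (B s i k * B s k j))); last by move=> s; rewrite sqE.
  rewrite expect_sum -[n%:R]mulr1 -sum_cst; apply: ler_sum => l _.
  rewrite expect_sum (bigD1 l) //= big1 => [|k kl].
    rewrite addr0 -[X in _ <= X](expect_cst r); apply: ler_expect => // s.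
  exact: expect_centered4.
rewrite expect_sum (_ : 2 * n%:R ^+ 3 = n%:R * (n%:R ^+ 2 + n%:R * n%:R)); last by ring.
rewrite -sum_cst; apply: ler_sum => i _.
rewrite expect_sum (bigD1 i) //=; apply: lerD.
  by have := entry i i; rewrite eqxx.
rewrite -sum_cst [X in _ <= X](bigD1 i) //= -[X in X <= _]add0r.
apply: lerD => //; apply: ler_sum => j ji.
by have := entry i j; rewrite eq_sym (negbTE ji).
Qed.

End FourthMoment.

(** * Tail bounds *)

Definition mass (R : realType) (I : finType) (r : I -> R)
    (Q : {ffun I -> bool} -> Prop) : R :=
  \sum_(s | `[< Q s >]) weight r s.

Lemma expRN_le (R : realType) (x : R) : 0 < x -> expR (- x) <= 4 / x ^+ 2.
Proof.
move=> x0; rewrite expRN -[leRHS]invrK lef_pV2 ?posrE ?expR_gt0 ?invr_gt0 //; last first.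
  by rewrite divr_gt0 ?exprn_gt0.
rewrite invf_div.
have -> : expR x = expR (x / 2) ^+ 2 by rewrite -expRM_natr mulfVK.
have -> : x ^+ 2 / 4 = (x / 2) ^+ 2 by field.
rewrite ler_pXn2r ?nnegrE ?expR_ge0 ?divr_ge0 ?ltW //.
by have := expR_ge1Dx (x / 2); lra.
Qed.

Section Mass.
Variables (R : realType) (I : finType) (r : I -> R).
Hypothesis r01 : forall e, 0 <= r e <= 1.
Implicit Types (s : {ffun I -> bool}) (Q : {ffun I -> bool} -> Prop).

Lemma markov_mass Q (Z : {ffun I -> bool} -> R) :
  (forall s, 0 <= Z s) -> (forall s, Q s -> 1 <= Z s) -> mass r Q <= expect r Z.
Proof.
move=> Z0 QZ; rewrite /mass /expect big_mkcond; apply: ler_sum => s _.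
case: asboolP => [/QZ Z1|_]; last by rewrite mulr_ge0 ?weight_ge0.
by rewrite -[leLHS]mulr1 ler_wpM2l ?weight_ge0.
Qed.

Lemma mass_le Q Q' : (forall s, Q s -> Q' s) -> mass r Q <= mass r Q'.
Proof.
move=> QQ; rewrite /mass big_mkcond [leRHS]big_mkcond; apply: ler_sum => s _.
case: asboolP => [/QQ q'|_]; first by rewrite asboolT.
by case: ifP => // _; exact: weight_ge0.
Qed.

Lemma mass_orP Q Q' : mass r (fun s => Q s \/ Q' s) <= mass r Q + mass r Q'.
Proof.
rewrite /mass big_mkcond [X in _ <= X + _]big_mkcond [X in _ <= _ + X]big_mkcond.
rewrite -big_split; apply: ler_sum => s _ /=.
have w0 := weight_ge0 r01 s.
case: asboolP => [|_].
  by case=> q; rewrite (asboolT q) ?lerDl ?lerDr //; case: ifP.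
by rewrite addr_ge0 //; case: ifP.
Qed.

Lemma mass_exists_le (J : finType) (Q : J -> {ffun I -> bool} -> Prop) (a : R) :
  (forall j, mass r (Q j) <= a) ->
  mass r (fun s => exists j, Q j s) <= #|J|%:R * a.
Proof.
move=> hQ.
apply: (@le_trans _ _ (\sum_j mass r (Q j))); last first.
  by rewrite mulr_natl -sumr_const; apply: ler_sum.
rewrite /mass big_mkcond.
under [leRHS]eq_bigr do rewrite big_mkcond.
rewrite exchange_big; apply: ler_sum => s _ /=.
have w0 := weight_ge0 r01 s.
case: asboolP => [[j q]|_]; last by apply: sumr_ge0 => j _; case: ifP.
rewrite (bigD1 j) //= asboolT // lerDl.
by apply: sumr_ge0 => k _; case: ifP.
Qed.

(** Chernoff's inequality; the sign of [c] selects the tail. *)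
Lemma chernoff_mass (J : finType) (P : pred J) (h : J -> I) (c tau : R) :
  {in P &, injective h} -> `|c| <= 1 / 2 ->
  mass r (fun s => tau <= c * \sum_(j | P j) ((s (h j))%:R - r (h j)))
    <= expR (2 * c ^+ 2 * #|J|%:R - tau).
Proof.
move=> hinj hc.
apply: le_trans (markov_mass (Z := fun s => expR (- tau)
   * expR (c * \sum_(j | P j) ((s (h j))%:R - r (h j)))) _ _) _.
- by move=> s; rewrite mulr_ge0 ?expR_ge0.
- move=> s hs; rewrite -expRD -[leLHS]expR0 ler_expR; lra.
rewrite expectZ addrC expRD ler_wpM2l ?expR_ge0 //.
exact: expect_expR_sum_le.
Qed.

End Mass.

Section Rows.
Variables (R : realType) (I : finType) (r : I -> R).
Hypothesis r01 : forall e, 0 <= r e <= 1.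

(** The two tails are those of [c = del / 4] and [c = - del / 4], the values that
    minimize the Chernoff exponent [2 c^2 m - |c| del m]. *)
Lemma row_deviation_mass (m : nat) (h : 'I_m -> I) (q del : R) : (0 < m)%N ->
  injective h -> (forall j, r (h j) = q) -> 0 < del -> del <= 1 ->
  mass r (fun s => ~ `|avg (fun j => (s (h j))%:R) - q| <= del)
    <= 2 * expR (- (del ^+ 2 * m%:R / 8)).
Proof.
move=> m0 hinj hr d0 d1.
have mn0 : 0 < m%:R :> R by rewrite ltr0n.
pose T c (s : {ffun I -> bool}) : Prop := del ^+ 2 * m%:R / 4
  <= c * \sum_(j | xpredT j) ((s (h j))%:R - r (h j)).
apply: (@le_trans _ _ (mass r (fun s => T (del / 4) s \/ T (- (del / 4)) s))).
  apply: mass_le => // s /negP; rewrite -ltNge => hs.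
  have e : \sum_j ((s (h j))%:R - r (h j))
      = m%:R * (avg (fun j => (s (h j))%:R) - q).
    under eq_bigr do rewrite hr.
    rewrite sumrB sumr_const card_ord mulrBr /avg mulVKf ?gt_eqF //.
    by rewrite mulr_natl.
  rewrite /T e; set A := avg _ - q in hs *.
  have hd : 0 <= del / 4 * m%:R by rewrite !mulr_ge0 ?ltW ?invr_ge0.
  have h2 : del / 4 * m%:R * del <= del / 4 * m%:R * `|A|.
    by rewrite ler_wpM2l // ltW.
  have [A0|A0] := leP 0 A.
    by left; move: h2; rewrite ger0_norm //; lra.
  by right; move: h2; rewrite ltr0_norm //; lra.
apply: le_trans (mass_orP r01 _ _) _.
have hT c : `|c| = del / 4 -> mass r (T c) <= expR (- (del ^+ 2 * m%:R / 8)).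
  move=> hc; apply: le_trans (chernoff_mass r01 _ _ _) _.
  - by move=> j k _ _; exact: hinj.
  - by rewrite hc; lra.
  rewrite ler_expR card_ord -real_normK ?num_real // hc.
  rewrite le_eqVlt; apply/orP; left; apply/eqP; by field.
have a1 : `|del / 4| = del / 4 by rewrite ger0_norm // divr_ge0 // ltW.
have := hT _ a1; have := hT (- (del / 4)); rewrite normrN a1 => /(_ erefl).
lra.
Qed.

End Rows.

Section Group.
Variables (R : realType) (I : finType) (r : I -> R).
Hypothesis r01 : forall e, 0 <= r e <= 1.
Variables (n : nat) (p : R) (c : 'I_n -> 'I_n -> I).
Hypothesis rc : forall i k, i != k -> r (c i k) = p.
Hypothesis c_inj : forall i k j l, i != k -> j != l -> c i k = c j l ->
  (i = j /\ k = l) \/ (i = l /\ k = j).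
Hypothesis c_sym : forall i k, c i k = c k i.
Hypotheses (p0 : 0 < p) (p1 : p < 1) (n32 : (32 <= n)%N).
Let psi (s : {ffun I -> bool}) i k : R := (s (c i k))%:R.
Let eps := p / 16.

(** There are only [n - 1] neighbours, which lowers the expected degree by [p];
    [32 <= n] makes this at most half of the allowed deviation [eps n]. *)
Lemma low_degree_mass i :
  mass r (fun s => ~ (p - eps) * n%:R <= \sum_(k | k != i) psi s i k)
    <= expR (- (eps ^+ 2 * n%:R / 32)).
Proof.
have pp0 := p0; have pp1 := p1.
have n0 : 32 <= n%:R :> R by rewrite ler_nat.
have e0 : 0 < eps by rewrite /eps; lra.
apply: (@le_trans _ _ (mass r (fun s => eps ^+ 2 * n%:R / 16
   <= - (eps / 8) * \sum_(k | k != i) ((s (c i k))%:R - r (c i k))))).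
  apply: mass_le => // s /negP; rewrite -ltNge => hs.
  have -> : \sum_(k | k != i) ((s (c i k))%:R - r (c i k))
      = \sum_(k | k != i) psi s i k - p * (n%:R - 1).
    rewrite sumrB; congr (_ - _).
    under eq_bigr => k ki do rewrite rc 1?eq_sym //.
    rewrite sumr_const cardC1 card_ord -[p *+ _]mulr_natr -subn1 natrB //.
    exact: leq_trans n32.
  set A := \sum_(k | _) _ in hs *.
  have h1 : A - p * (n%:R - 1) <= - (eps * n%:R / 2).
    have : p * 32 <= p * n%:R by rewrite ler_wpM2l // ltW.
    move: hs; rewrite /eps; lra.
  have e8 : 0 <= eps / 8 by lra.
  have := ler_wpM2l e8 h1; rewrite expr2; lra.
apply: le_trans (chernoff_mass r01 _ _ _) _.
- move=> k l ki li h; rewrite !unfold_in in ki li.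
  have ik : i != k by rewrite eq_sym.
  have il : i != l by rewrite eq_sym.
  by case: (c_inj ik il h) => [[]|[-> ->]].
- rewrite normrN ger0_norm /eps; lra.
rewrite ler_expR card_ord le_eqVlt; apply/orP; left; apply/eqP.
by rewrite sqrrN; field.
Qed.

Lemma large_frobenius_mass :
  mass r (fun s => ~ \sum_i \sum_k (\sum_l centered p (psi s) i l
                         * centered p (psi s) l k) ^+ 2 <= (eps * n%:R) ^+ 4)
    <= 2 / eps ^+ 4 / n%:R.
Proof.
have pp0 := p0.
have n0 : 0 < n%:R :> R by rewrite ltr0n (leq_trans _ n32).
have e0 : 0 < eps by rewrite /eps; lra.
have en0 : 0 < (eps * n%:R) ^+ 4 by rewrite exprn_gt0 ?mulr_gt0.
pose F s := \sum_i \sum_k (\sum_l centered p (psi s) i l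
                         * centered p (psi s) l k) ^+ 2.
apply: le_trans (markov_mass (Z := fun s => ((eps * n%:R) ^+ 4)^-1 * F s) r01 _ _) _.
- move=> s; rewrite mulr_ge0 ?invr_ge0 ?(ltW en0) //.
  by do 2 (apply: sumr_ge0 => ? _); exact: sqr_ge0.
- move=> s /negP; rewrite -ltNge => /ltW hs.
  by rewrite mulrC ler_pdivlMr // mul1r.
rewrite expectZ.
have := ler_wpM2l _ (expect_frobenius_le r01 rc c_inj).
move=> /(_ ((eps * n%:R) ^+ 4)^-1) H; apply: le_trans (H _) _.
  by rewrite invr_ge0 ltW.
rewrite le_eqVlt; apply/orP; left; apply/eqP; field.
by rewrite !gt_eqF.
Qed.

(** Both contributions are of order [1 / n]: the union over [n] degrees multiplies
    an exponential tail, bounded here by the inverse square of its exponent. *)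
Lemma ill_mixed_mass : mass r (fun s => ~ well_mixed p eps (psi s))
    <= (4 * (32 / eps ^+ 2) ^+ 2 + 2 / eps ^+ 4) / n%:R.
Proof.
have pp0 := p0.
have n0 : 0 < n%:R :> R by rewrite ltr0n (leq_trans _ n32).
have e0 : 0 < eps by rewrite /eps; lra.
pose Q1 s := exists i, ~ (p - eps) * n%:R <= \sum_(k | k != i) psi s i k.
pose Q2 s := ~ \sum_i \sum_k (\sum_l centered p (psi s) i l
                         * centered p (psi s) l k) ^+ 2 <= (eps * n%:R) ^+ 4.
apply: (@le_trans _ _ (mass r (fun s => Q1 s \/ Q2 s))).
  apply: mass_le => // s nwm; apply: contrapT => /not_orP[q1 q2]; apply: nwm.
  split.
  - by move=> i k; rewrite /psi c_sym.
  - by move=> i k; rewrite /psi; case: (s _); rewrite ?lexx ?ler01.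
  - by move=> i; apply: contrapT => h; apply: q1; exists i.
  - exact: contrapT.
apply: le_trans (mass_orP r01 _ _) _; rewrite mulrDl lerD //; last first.
  exact: large_frobenius_mass.
apply: le_trans (mass_exists_le r01 low_degree_mass) _; rewrite card_ord.
have x0 : 0 < eps ^+ 2 * n%:R / 32 by rewrite divr_gt0 ?mulr_gt0 ?exprn_gt0.
apply: le_trans (ler_wpM2l (ltW n0) (expRN_le x0)) _.
rewrite le_eqVlt; apply/orP; left; apply/eqP; field.
by rewrite !gt_eqF.
Qed.

End Group.

(** * From random variables to configurations *)

Section Edges.
Variables (n : nat) (e0 : upair n).

(** The default [e0] is returned on the diagonal, where no edge exists. *)
Definition edge (i k : 'I_n) : upair n :=
  insubd e0 (if (i < k)%N then (i, k) else (k, i)).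

Lemma val_edge i k : i != k ->
  val (edge i k) = if (i < k)%N then (i, k) else (k, i).
Proof.
move=> ik; rewrite /edge insubdK // unfold_in.
by case: (ltngtP i k) => // /val_inj /eqP; rewrite (negbTE ik).
Qed.

Lemma edge_sym i k : edge i k = edge k i.
Proof.
rewrite /edge; case: (ltngtP i k) => // /val_inj ->.
by [].
Qed.

Lemma edge_inj i k j l : i != k -> j != l -> edge i k = edge j l ->
  (i = j /\ k = l) \/ (i = l /\ k = j).
Proof.
move=> ik jl /(congr1 val); rewrite !val_edge //.
by case: ltnP => _; case: ltnP => _ [-> ->]; tauto.
Qed.

End Edges.

Section FiniteEvents.
Variables (R : realType) (d : measure_display) (T : measurableType d).
Variables (P : probability T R) (I : finType) (X : I -> {RV P >-> bool}).

Definition config (w : T) : {ffun I -> bool} := [ffun e => X e w].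

Lemma config_eqE s : [set w | config w = s] =
  \bigcap_(e in [set` [set: I]%SET]) (X e @^-1` [set s e]).
Proof.
apply/seteqP; split=> w /=.
  by move=> <- e _ /=; rewrite ffunE.
move=> h; apply/ffunP => e; rewrite ffunE.
by apply: (h e); rewrite /= inE.
Qed.

Lemma measurable_config_eq s : measurable [set w | config w = s].
Proof.
rewrite config_eqE; apply: fin_bigcap_measurable => // e _.
by rewrite -[_ @^-1` _]setTI; exact: measurable_funP.
Qed.

Lemma measurable_config (Q : {ffun I -> bool} -> Prop) :
  measurable [set w | Q (config w)].
Proof.
have -> : [set w | Q (config w)] = \bigcup_(s in Q) [set w | config w = s].
  by apply/seteqP; split=> w /= => [h|[s h ->]//]; exists (config w).
by apply: fin_bigcup_measurable => // s _; exact: measurable_config_eq.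
Qed.

(** A union bound over the finitely many configurations of the event. *)
Lemma probability_config_le (Q : {ffun I -> bool} -> Prop) :
  (P [set w | Q (config w)]
    <= \sum_(s | `[< Q s >]) P [set w | config w = s])%E.
Proof.
have step (t : seq {ffun I -> bool}) :
    (P [set w | config w \in t /\ Q (config w)]
      <= \sum_(s <- t | `[< Q s >]) P [set w | config w = s])%E.
  elim: t => [|a t IH].
    rewrite big_nil [X in P X](_ : _ = set0) ?measure0 //.
    by rewrite -subset0 => w [].
  rewrite big_cons; case: asboolP => Qa.
    apply: le_trans (leeD2l _ IH).
    apply: le_trans (measureU2 _ _ _); last 2 first.
    - exact: measurable_config_eq.
    - exact: (measurable_config (fun s => s \in t /\ Q s)).
    apply: le_measure; rewrite ?inE.
    - exact: (measurable_config (fun s => s \in a :: t /\ Q s)).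
    - apply: measurableU; first exact: measurable_config_eq.
      exact: (measurable_config (fun s => s \in t /\ Q s)).
    - move=> w /= []; rewrite inE => /orP[/eqP ->|h q]; first by left.
      by right.
  apply: le_trans IH; apply: le_measure; rewrite ?inE.
  - exact: (measurable_config (fun s => s \in a :: t /\ Q s)).
  - exact: (measurable_config (fun s => s \in t /\ Q s)).
  - move=> w /= [+ q]; rewrite inE => /orP[/eqP h|//].
    by rewrite h in q.
have := step (index_enum _); apply: le_trans.
apply: le_measure; rewrite ?inE.
- exact: measurable_config.
- exact: (measurable_config (fun s => s \in index_enum _ /\ Q s)).
- by move=> w /= q; rewrite mem_index_enum.
Qed.

Lemma probability_config_le_mass (r : I -> R) (Q : {ffun I -> bool} -> Prop) :
  (forall e, 0 <= r e <= 1) -> mutually_independent X ->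
  (forall e, distribution P (X e) =1 bernoulli_prob (r e)) ->
  (P [set w | Q (config w)] <= (mass r Q)%:E)%E.
Proof.
move=> r01 indep law; apply: le_trans (probability_config_le Q) _.
rewrite /mass -sumEFin le_eqVlt; apply/orP; left; apply/eqP.
apply: eq_bigr => s _.
rewrite config_eqE indep // /weight -prodEFin.
apply: eq_big => [e|e _]; first by rewrite inE.
rewrite -[LHS]/(distribution P (X e) [set s e]) law bernoulli_probE //.
have memE b b' : (b \in [set b']) = (b == b') by apply/idP/eqP; rewrite inE.
rewrite !diracE !memE; case: (s e) => /=.
  by rewrite mule1 mule0 adde0.
by rewrite mule1 mule0 add0e.
Qed.

End FiniteEvents.

Definition mixing_cost (R : realType) (p : R) : R :=
  4 * (32 / (p / 16) ^+ 2) ^+ 2 + 2 / (p / 16) ^+ 4.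

Section RandomInteractions.
Variables (R : realType) (p q : R) (N1 N2 : nat) (e1 : upair N1) (e2 : upair N2).
Local Notation slot := (upair N1 + upair N2 + 'I_N1 * 'I_N2)%type.

Definition rate (e : slot) : R := if e is inr _ then q else p.

Definition group1 (s : {ffun slot -> bool}) (i k : 'I_N1) : R :=
  (s (inl (inl (edge e1 i k))))%:R.

Definition group2 (s : {ffun slot -> bool}) (j l : 'I_N2) : R :=
  (s (inl (inr (edge e2 j l))))%:R.

Definition between (s : {ffun slot -> bool}) (i : 'I_N1) (j : 'I_N2) : R :=
  (s (inr (i, j)))%:R.

(** [e1] and [e2] only provide default values on the diagonals of the arrays. *)
Definition typical (del : R) (s : {ffun slot -> bool}) : Prop :=
  [/\ well_mixed p (p / 16) (group1 s), well_mixed p (p / 16) (group2 s),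
      well_balanced q del (between s)
    & well_balanced q del (fun j i => between s i j)].

Hypotheses (hp : 0 < p < 1) (hq : 0 < q < 1).

Lemma rate01 e : 0 <= rate e <= 1.
Proof.
have /andP[? ?] := hp; have /andP[? ?] := hq.
by case: e => [?|?] /=; rewrite !ltW.
Qed.

Lemma atypical_mass (del : R) : 0 < del <= 1 -> (32 <= N1)%N -> (32 <= N2)%N ->
  mass rate (fun s => ~ typical del s) <=
  mixing_cost p / N1%:R + mixing_cost p / N2%:R
  + N1%:R * (2 * expR (- (del ^+ 2 * N2%:R / 8)))
  + N2%:R * (2 * expR (- (del ^+ 2 * N1%:R / 8))).
Proof.
move=> /andP[d0 d1] n1 n2.
have /andP[p0 p1] := hp.
have n10 : (0 < N1)%N by apply: leq_trans n1.
have n20 : (0 < N2)%N by apply: leq_trans n2.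
pose B1 s := ~ well_mixed p (p / 16) (group1 s).
pose B2 s := ~ well_mixed p (p / 16) (group2 s).
pose B3 s := exists i, ~ `|avg (between s i) - q| <= del.
pose B4 s := exists j, ~ `|avg (fun i => between s i j) - q| <= del.
apply: (@le_trans _ _ (mass rate (fun s => ((B1 s \/ B2 s) \/ B3 s) \/ B4 s))).
  apply: (mass_le rate01) => s nt; apply: contrapT.
  move=> /not_orP[/not_orP[/not_orP[b1 b2] b3] b4]; apply: nt.
  have bt01 i j : 0 <= between s i j <= 1.
    by rewrite /between; case: (s _); rewrite ?lexx ?ler01.
  split; [exact: contrapT|exact: contrapT| |]; split=> // k.
    by apply: contrapT => h; apply: b3; exists k.
  by apply: contrapT => h; apply: b4; exists k.
apply: le_trans (mass_orP rate01 _ _) _; apply: lerD; last first.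
  rewrite -[N2 in leRHS]card_ord; apply: (mass_exists_le rate01) => j.
  apply: (row_deviation_mass rate01 (h := fun i => inr (i, j))) => //.
  by move=> i i' [].
apply: le_trans (mass_orP rate01 _ _) _; apply: lerD; last first.
  rewrite -[N1 in leRHS]card_ord; apply: (mass_exists_le rate01) => i.
  apply: (row_deviation_mass rate01 (h := fun j => inr (i, j))) => //.
  by move=> j j' [].
apply: le_trans (mass_orP rate01 _ _) _; apply: lerD.
  apply: (ill_mixed_mass rate01 (c := fun i k => inl (inl (edge e1 i k)))) => //.
    by move=> i k j l ik jl [] /(edge_inj ik jl).
  by move=> i k; rewrite edge_sym.
apply: (ill_mixed_mass rate01 (c := fun i k => inl (inr (edge e2 i k)))) => //.
  by move=> i k j l ik jl [] /(edge_inj ik jl).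
by move=> i k; rewrite edge_sym.
Qed.

Variable S : random_interactions p q N1 N2.

Definition draw (w : ri_space S) : {ffun slot -> bool} :=
  config (interaction_family (ri_psi1 S) (ri_psi2 S) (ri_psi12 S)) w.

Lemma ri_law_family e :
  distribution (ri_prob S)
    (interaction_family (ri_psi1 S) (ri_psi2 S) (ri_psi12 S) e)
  =1 bernoulli_prob (rate e).
Proof.
case: e => [[[[i k] /= ik]|[[j l] /= jl]]|[i j]] /=.
- by apply: ri_law1; rewrite -val_eqE neq_ltn ik.
- by apply: ri_law2; rewrite -val_eqE neq_ltn jl.
- exact: ri_law12.
Qed.

Lemma probability_draw_le (Q : {ffun slot -> bool} -> Prop) :
  (ri_prob S [set w | Q (draw w)] <= (mass rate Q)%:E)%E.
Proof.
apply: probability_config_le_mass; first exact: rate01.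
  exact: ri_indep.
exact: ri_law_family.
Qed.

Lemma group1_draw w i k : i != k ->
  group1 (draw w) i k = (ri_psi1 S i k w : nat)%:R.
Proof.
move=> ik; rewrite /group1 /draw /config ffunE /= val_edge //.
by case: ltnP => //= _; rewrite ri_sym1.
Qed.

Lemma group2_draw w j l : j != l ->
  group2 (draw w) j l = (ri_psi2 S j l w : nat)%:R.
Proof.
move=> jl; rewrite /group2 /draw /config ffunE /= val_edge //.
by case: ltnP => //= _; rewrite ri_sym2.
Qed.

Lemma between_draw w i j : between (draw w) i j = (ri_psi12 S i j w : nat)%:R.
Proof. by rewrite /between /draw /config ffunE. Qed.

End RandomInteractions.

(** * The scale of the degree fluctuations *)

(** Large enough for the tails [exp (- del^2 m / 8)] to beat the number of rows,
    yet of smaller order than [N^(alpha / 2 - 1 / 2)] for every [alpha > 0]. *)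
Definition degree_scale (R : realType) (N : nat) : R :=
  4 * ln N%:R / Num.sqrt N%:R.

Section DegreeScale.
Variable R : realType.

(** [ln y <= y] applied to [y = x^(alpha / 2)]. *)
Lemma sqr_ln_le (alpha x : R) : 0 < alpha -> 1 <= x ->
  ln x ^+ 2 <= 4 / alpha ^+ 2 * x `^ alpha.
Proof.
move=> a0 x1; have x0 : 0 < x by lra.
have h : ln x <= 2 / alpha * x `^ (alpha / 2).
  have y0 : 0 < x `^ (alpha / 2) by exact: powR_gt0.
  have : ln (x `^ (alpha / 2)) <= x `^ (alpha / 2).
    have := @le_ln1Dx R (x `^ (alpha / 2) - 1).
    by rewrite [1 + _]addrC subrK => h; have := h; lra.
  rewrite ln_powR => h.
  have a2 : 0 <= 2 / alpha by rewrite divr_ge0 // ltW.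
  have := ler_wpM2l a2 h; rewrite mulrA (_ : 2 / alpha * (alpha / 2) = 1) ?mul1r //.
  by field; rewrite gt_eqF.
apply: (@le_trans _ _ ((2 / alpha * x `^ (alpha / 2)) ^+ 2)).
  rewrite ler_pXn2r // nnegrE ?ln_ge0 // mulr_ge0 ?powR_ge0 //.
  by rewrite divr_ge0 // ltW.
rewrite exprMn -[(x `^ _) ^+ 2]powR_mulrn ?powR_ge0 // -powRrM mulfVK //.
by rewrite exprMn exprVn -natrX.
Qed.

Lemma sqr_degree_scale (N : nat) : (0 < N)%N ->
  degree_scale R N ^+ 2 = 16 * (ln N%:R ^+ 2 / N%:R).
Proof.
move=> N0; rewrite /degree_scale !exprMn exprVn sqr_sqrtr //.
by rewrite -natrX mulrA.
Qed.

Lemma degree_scale_gt0 (N : nat) : (1 < N)%N -> 0 < degree_scale R N.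
Proof.
move=> N1; rewrite /degree_scale divr_gt0 ?mulr_gt0 ?ln_gt0 ?ltr1n //.
by rewrite sqrtr_gt0 ltr0n (ltn_trans _ N1).
Qed.

Lemma sqr_degree_scale_le (alpha : R) (N : nat) : 0 < alpha -> (0 < N)%N ->
  degree_scale R N ^+ 2 <= 16 * (4 / alpha ^+ 2) / N%:R `^ (1 - alpha).
Proof.
move=> a0 N0; rewrite sqr_degree_scale //.
have n0 : 0 < N%:R :> R by rewrite ltr0n.
have h : ln N%:R ^+ 2 <= 4 / alpha ^+ 2 * N%:R `^ alpha :> R.
  by apply: sqr_ln_le => //; rewrite ler1n.
rewrite -mulrA ler_pM2l // ler_pdivrMr //; apply: le_trans h _.
rewrite -[leRHS]mulrA ler_wpM2l ?divr_ge0 ?sqr_ge0 //.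
rewrite -[X in _ <= _ * X](powRr1 (ltW n0)) -powRN -powRD; last first.
  by rewrite (gt_eqF n0) implybT.
by rewrite opprB subrK.
Qed.

Lemma degree_scale_small (c : R) : 0 < c ->
  exists M, forall N, (M <= N)%N -> degree_scale R N <= c.
Proof.
move=> c0; pose b : R := 16 * (4 / (1 / 2) ^+ 2) / c ^+ 2.
have b0 : 0 < b by rewrite /b !(divr_gt0, mulr_gt0, exprn_gt0).
exists (Num.truncn (b ^+ 2)).+2 => N hN.
have N1 : (1 < N)%N by apply: leq_trans hN.
have N0 : (0 < N)%N by apply: ltn_trans N1.
rewrite -(@ler_pXn2r _ 2) ?nnegrE ?(ltW c0) ?(ltW (degree_scale_gt0 N1)) //.
have a0 : 0 < 1 / 2 :> R by lra.
apply: le_trans (sqr_degree_scale_le a0 N0) _.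
have n0 : 0 < N%:R :> R by rewrite ltr0n.
rewrite (_ : 1 - 1 / 2 = 2^-1); last by field.
rewrite powR12_sqrt // ler_pdivrMr ?sqrtr_gt0 //.
rewrite [leRHS]mulrC -ler_pdivrMr ?exprn_gt0 // -/b.
rewrite -[b]ger0_norm ?(ltW b0) // -sqrtr_sqr ler_wsqrtr //.
have := truncnS_gt (b ^+ 2) => /ltW /le_trans; apply.
by rewrite ler_nat ltnW.
Qed.

(** The exponent is at least [2 (ln N)^2 >= 2 ln N]. *)
Lemma row_tail_le (N m : nat) : expR 1 <= N%:R :> R -> (N <= m)%N ->
  expR (- (degree_scale R N ^+ 2 * m%:R / 8)) <= (N%:R ^+ 2)^-1.
Proof.
move=> eN Nm.
have n1 : 1 <= N%:R :> R by have := expR_ge1Dx (1 : R); lra.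
have n0 : 0 < N%:R :> R by lra.
have N0 : (0 < N)%N by rewrite -(ltr0n R).
have l1 : 1 <= ln N%:R :> R.
  by rewrite -[leLHS]expRK ler_ln ?posrE ?expR_gt0.
rewrite -[N%:R in leRHS]lnK ?posrE // -expRM_natr -expRN ler_expR lerN2.
rewrite sqr_degree_scale //.
have h : N%:R / N%:R <= m%:R / N%:R :> R.
  by rewrite ler_pM2r ?invr_gt0 // ler_nat.
rewrite divff ?gt_eqF // in h.
have l2 : ln N%:R <= ln N%:R ^+ 2 :> R by rewrite expr2 ler_peMl //; lra.
have := ler_wpM2l (sqr_ge0 (ln N%:R : R)) h.
rewrite (_ : 16 * (ln N%:R ^+ 2 / N%:R) * m%:R / 8
   = 2 * (ln N%:R ^+ 2 * (m%:R / N%:R))); last by field; rewrite gt_eqF.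
lra.
Qed.

End DegreeScale.

(** * The separation event and its probability *)

Definition separates (R : realType) (p lm lp C : R) (d n m : nat)
    (psi1 : 'I_n -> 'I_n -> R) (psi2 : 'I_m -> 'I_m -> R)
    (phi : 'I_n -> 'I_m -> R) : Prop :=
  forall (x : 'I_n -> R -> 'rV[R]_d) (y : 'I_m -> R -> 'rV[R]_d),
  solution psi1 psi2 phi x y ->
  mean (x ^~ 0) != mean (y ^~ 0) ->
  lambda2 (x ^~ 0) (y ^~ 0) <= lp ->
  forall t, 0 <= t ->
  [/\ mean (x ^~ t) != mean (y ^~ t),
      lambda2 (x ^~ t) (y ^~ t)
        <= lm + (lambda2 (x ^~ 0) (y ^~ 0) - lm) * expR (- (p / 2) * t)
    & forall alpha : R, 0 < alpha < 1 -> lambda_sup (x ^~ t) (y ^~ t)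
        <= C * (lm + lambda_sup (x ^~ 0) (y ^~ 0) * expR (- (p / 2) * t))].

Lemma eq_solution (R : realType) (d n m : nat)
    (psi1 psi1' : 'I_n -> 'I_n -> R) (psi2 psi2' : 'I_m -> 'I_m -> R)
    (phi phi' : 'I_n -> 'I_m -> R)
    (x : 'I_n -> R -> 'rV[R]_d) (y : 'I_m -> R -> 'rV[R]_d) :
  (forall i k, i != k -> psi1 i k = psi1' i k) ->
  (forall j l, j != l -> psi2 j l = psi2' j l) ->
  (forall i j, phi i j = phi' i j) ->
  solution psi1 psi2 phi x y -> solution psi1' psi2' phi' x y.
Proof.
move=> e1 e2 e3 [cx cy dx dy]; split=> // [i|j] t t0.
  have := dx i t t0.
  congr (is_derive _ _ _ _); congr (_ *: _ - _ *: _).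
    by apply: eq_bigr => k ki; rewrite e1 // eq_sym.
  by apply: eq_bigr => j _; rewrite e3.
have := dy j t t0.
congr (is_derive _ _ _ _); congr (_ *: _ - _ *: _).
  by apply: eq_bigr => l lj; rewrite e2 // eq_sym.
by apply: eq_bigr => i _; rewrite e3.
Qed.

Lemma typical_separates (R : realType) (p q del : R) (d n m : nat)
    (e1 : upair n) (e2 : upair m) s :
  0 < p < 1 -> 0 < q < 1 -> 0 < del <= p / 16 ->
  typical p q e1 e2 del s ->
  @separates R p (16 * del ^+ 2 / p ^+ 2) (p ^+ 2 / (128 * del ^+ 2))
    (416 / p ^+ 2) d n m (group1 R e1 s) (group2 R e2 s) (between R s).
Proof.
move=> /andP[p0 p1] /andP[/ltW q0 _] /andP[d0 dp] [wm1 wm2 wb wbT] x y sol sep l0 t t0.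
have n0 : (0 < n)%N by apply: leq_ltn_trans (ltn_ord (val e1).1).
have m0 : (0 < m)%N by apply: leq_ltn_trans (ltn_ord (val e2).1).
have l0' : 128 * del ^+ 2 * lambda2 (x^~ 0) (y^~ 0) <= p ^+ 2.
  by rewrite mulrC -ler_pdivlMr // mulr_gt0 ?exprn_gt0.
split.
- exact: (mean_separated n0 m0 p0 d0 dp wm1 wm2 wb wbT sol sep l0' t0).
- exact: (lambda2_decay n0 m0 p0 d0 dp wm1 wm2 wb wbT sol sep l0' t0).
- move=> _ _.
  exact: (lambda_sup_decay n0 m0 p0 p1 q0 d0 dp wm1 wm2 wb wbT sol sep l0' t0).
Qed.

(** The event depends on the sample only through finitely many booleans. *)
Lemma measurable_separates (R : realType) (p q lm lp C : R) (d N1 N2 : nat)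
    (S : random_interactions p q N1 N2) :
  measurable [set w : ri_space S | @separates R p lm lp C d N1 N2
     (fun i k => (ri_psi1 S i k w : nat)%:R)
     (fun j l => (ri_psi2 S j l w : nat)%:R)
     (fun i j => (ri_psi12 S i j w : nat)%:R)].
Proof.
pose X (e : 'I_N1 * 'I_N1 + 'I_N2 * 'I_N2 + 'I_N1 * 'I_N2) :=
  match e with
  | inl (inl ik) => ri_psi1 S ik.1 ik.2
  | inl (inr jl) => ri_psi2 S jl.1 jl.2
  | inr ij => ri_psi12 S ij.1 ij.2
  end.
have := measurable_config X (fun s => @separates R p lm lp C d N1 N2
     (fun i k => (s (inl (inl (i, k))) : nat)%:R)
     (fun j l => (s (inl (inr (j, l))) : nat)%:R)
     (fun i j => (s (inr (i, j)) : nat)%:R)).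
congr (measurable _); apply/funext => w /=.
by congr (separates _ _ _ _ _ _ _); apply/funext => i; apply/funext => k;
  rewrite /config ffunE.
Qed.

Lemma large_probabilityP (R : realType) (p q kappa K : R) (M : nat)
    (S : forall N1 N2 : nat, random_interactions p q N1 N2)
    (A : forall N1 N2 : nat, set (ri_space (S N1 N2))) :
  0 <= K -> (forall N1 N2, measurable (A N1 N2)) ->
  (forall N1 N2 : nat, kappa^-1 * N1%:R <= N2%:R :> R ->
     N2%:R <= kappa * N1%:R :> R -> (M <= minn N1 N2)%N ->
     (ri_prob (S N1 N2) (~` A N1 N2) <= (K / (minn N1 N2)%:R)%:E)%E) ->
  large_probability kappa A.
Proof.
move=> K0 mA hA; split=> //.
have FF : Filter (comparable_infty kappa : set_system (nat * nat)).
  by rewrite /comparable_infty; exact: within_filter.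
apply: cvg_EFin.
  by apply: nearW => -[N1 N2]; exact: fin_num_measure.
apply/cvgrPdist_le => eps eps0.
apply/comparable_inftyP; exists (maxn M (Num.truncn (K / eps)).+1).
move=> N1 N2 c1 c2; rewrite geq_max => /andP[hM hK] /=.
set P := ri_prob (S N1 N2); set N := minn N1 N2 in hM hK *.
have n0 : 0 < N%:R :> R by rewrite ltr0n (leq_trans _ hK).
have PA1 : (P (A N1 N2) <= 1)%E by exact: probability_le1.
have fA : P (A N1 N2) \is a fin_num by exact: fin_num_measure.
have := hA N1 N2 c1 c2 hM; rewrite probability_setC // -/P -/N.
move: PA1; rewrite -(fineK fA) -EFinB !lee_fin => P1 h.
rewrite ger0_norm ?subr_ge0 //; apply: le_trans h _.
rewrite ler_pdivrMr // mulrC -ler_pdivrMr //.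
by apply: ltW; apply: lt_le_trans (truncnS_gt _) _; rewrite ler_nat.
Qed.

(** Comparability enters only here: the larger group has at most [(1 + kappa) N]
    members, so the tails [N^-2] of its rows sum to [O(1 / N)]. *)
Lemma atypical_probability_le (R : realType) (p q kappa : R) :
  0 < p < 1 -> 0 < q < 1 -> 0 < kappa ->
  exists M : nat, forall (N1 N2 : nat) (S : random_interactions p q N1 N2)
    (e1 : upair N1) (e2 : upair N2),
    kappa^-1 * N1%:R <= N2%:R :> R -> N2%:R <= kappa * N1%:R :> R ->
    (M <= minn N1 N2)%N ->
    (ri_prob S [set w | ~ typical p q e1 e2 (degree_scale R (minn N1 N2))
                            (draw w)]
       <= ((2 * mixing_cost p + 4 * (1 + kappa)) / (minn N1 N2)%:R)%:E)%E.
Proof.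
move=> hp hq k0.
have [M1 hM1] := @degree_scale_small R 1 ltr01.
exists (maxn (maxn M1 32) (Num.truncn (expR 1 : R)).+1).
move=> N1 N2 S e1 e2 c1 c2; set N := minn N1 N2.
rewrite !geq_max => /andP[/andP[h1 h32] he].
have eN : expR 1 <= N%:R :> R.
  by apply: ltW; apply: lt_le_trans (truncnS_gt _) _; rewrite ler_nat.
have n0 : 0 < N%:R :> R by rewrite ltr0n (leq_trans _ h32).
have NN1 : (N <= N1)%N := geq_minl _ _.
have NN2 : (N <= N2)%N := geq_minr _ _.
apply: le_trans (probability_draw_le hp hq S
  (fun s => ~ typical p q e1 e2 (degree_scale R N) s)) _.
rewrite lee_fin.
have del01 : 0 < degree_scale R N <= 1.
  by rewrite hM1 // andbT degree_scale_gt0 // (leq_trans _ h32).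
apply: le_trans (atypical_mass e1 e2 hp hq del01 _ _) _.
- exact: leq_trans h32 NN1.
- exact: leq_trans h32 NN2.
have p0 : 0 < p by case/andP: hp.
have cost0 : 0 <= mixing_cost p.
  have p16 : 0 < p / 16 by lra.
  rewrite /mixing_cost addr_ge0 //; first by rewrite mulr_ge0 // sqr_ge0.
  by rewrite divr_ge0 // exprn_ge0 // ltW.
have costle m : (N <= m)%N -> mixing_cost p / m%:R <= mixing_cost p / N%:R.
  move=> Nm; apply: ler_wpM2l; first exact: cost0.
  rewrite lef_pV2 ?posrE ?ler_nat //.
  by rewrite ltr0n (leq_trans _ Nm) // (leq_trans _ h32).
have sizele m : (m == N1) || (m == N2) -> m%:R <= (1 + kappa) * N%:R :> R.
  have k1 : 1 <= 1 + kappa by lra.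
  have N12 : N1%:R <= kappa * N2%:R :> R by rewrite -ler_pdivrMl.
  have le1 m' : N%:R = m'%:R :> R -> m'%:R <= (1 + kappa) * N%:R :> R.
    by move=> <-; rewrite ler_peMl // ltW.
  rewrite /N; case: (leqP N1 N2) => h /orP[] /eqP -> //.
  - by rewrite ler_peMl.
  - by apply: le_trans c2 _; rewrite ler_wpM2r //; lra.
  - by apply: le_trans N12 _; rewrite ler_wpM2r //; lra.
  - by rewrite ler_peMl.
have tail m m' : (m == N1) || (m == N2) -> (N <= m')%N ->
    m%:R * (2 * expR (- (degree_scale R N ^+ 2 * m'%:R / 8)))
      <= 2 * (1 + kappa) / N%:R.
  move=> hm hm'.
  apply: (@le_trans _ _ ((1 + kappa) * N%:R * (2 * (N%:R ^+ 2)^-1))).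
    by rewrite ler_pM ?mulr_ge0 ?expR_ge0 ?sizele // ler_pM2l // row_tail_le.
  rewrite le_eqVlt; apply/orP; left; apply/eqP; field.
  by rewrite gt_eqF.
have := costle _ NN1; have := costle _ NN2.
have := tail N1 N2; have := tail N2 N1; rewrite !eqxx orbT.
move=> /(_ isT NN1) t1 /(_ isT NN2) t2 t3 t4.
rewrite (_ : _ / N%:R = mixing_cost p / N%:R + mixing_cost p / N%:R
  + 2 * (1 + kappa) / N%:R + 2 * (1 + kappa) / N%:R).
  by rewrite !lerD.
by field; rewrite gt_eqF.
Qed.

(** * Separation with large probability *)

(** The constants in the bounds on the thresholds come from
    [(ln N)^2 <= 4 / alpha^2 * N^alpha], so they depend on [p] and [alpha] alone. *)
Theorem theorem2p2 (R : realType) (p q : R)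
    (hp : 0 < p < 1) (hq : 0 < q < 1) :
  exists C c : R -> R,
    (forall alpha : R, 0 < alpha < 1 -> 0 < C alpha /\ 0 < c alpha) /\
  forall kappa : R, 0 < kappa ->
  exists (C' : R -> R) (N0 : nat) (lambda_minus lambda_plus : nat -> R),
    [/\ forall alpha : R, 0 < alpha < 1 -> 0 < C' alpha,
        forall (N : nat) (alpha : R), (N0 <= N)%N -> 0 < alpha < 1 ->
          lambda_minus N <= C alpha / N%:R `^ (1 - alpha) /\
          c alpha * N%:R `^ (1 - alpha) <= lambda_plus N
      & forall (d : nat) (S : forall N1 N2 : nat, random_interactions p q N1 N2),
          large_probability kappa (fun N1 N2 : nat =>
            [set w : ri_space (S N1 N2) |
              forall (x : 'I_N1 -> R -> 'rV[R]_d) (y : 'I_N2 -> R -> 'rV[R]_d),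
                let N := minn N1 N2 in
                let mu := p / 2 in
                let xbar := fun t => mean (x ^~ t) in
                let ybar := fun t => mean (y ^~ t) in
                let lambda := fun t => lambda2 (x ^~ t) (y ^~ t) in
                let lambda_tilde := fun t => lambda_sup (x ^~ t) (y ^~ t) in
                random_solution w x y ->
                xbar 0 != ybar 0 ->
                lambda 0 <= lambda_plus N ->
                forall t, 0 <= t ->
                  [/\ xbar t != ybar t,
                      lambda t <= lambda_minus N +
                        (lambda 0 - lambda_minus N) * expR (- mu * t)
                    & forall alpha : R, 0 < alpha < 1 ->
                        lambda_tilde t <= C' alpha *
                          (lambda_minus N + lambda_tilde 0 * expR (- mu * t))]])].
Proof.
have /andP[p0 p1] := hp.
have p2 : 0 < p ^+ 2 by rewrite exprn_gt0.
pose b (alpha : R) := 16 * (4 / alpha ^+ 2).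
have b0 alpha : 0 < alpha -> 0 < b alpha.
  by move=> a0; rewrite /b mulr_gt0 // divr_gt0 // exprn_gt0.
exists (fun alpha => 16 / p ^+ 2 * b alpha).
exists (fun alpha => p ^+ 2 / (128 * b alpha)).
split.
  move=> alpha /andP[/b0 ba _]; split; last by rewrite divr_gt0 // mulr_gt0.
  by rewrite mulr_gt0 // divr_gt0.
move=> kappa k0.
pose del := degree_scale R.
exists (fun=> 416 / p ^+ 2), 2%N.
exists (fun N => 16 * del N ^+ 2 / p ^+ 2), (fun N => p ^+ 2 / (128 * del N ^+ 2)).
split.
- by move=> alpha _; rewrite divr_gt0.
- move=> N alpha N2 /andP[a0 a1].
  have N0 : (0 < N)%N by exact: ltn_trans N2.
  have dle := sqr_degree_scale_le a0 N0.
  have d0 : 0 < del N ^+ 2 by rewrite exprn_gt0 // degree_scale_gt0.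
  have y0 : 0 < N%:R `^ (1 - alpha) :> R by rewrite powR_gt0 // ltr0n.
  split.
    rewrite [X in X <= _]mulrAC -[X in _ <= X]mulrA ler_wpM2l //.
    by rewrite divr_ge0 // ltW.
  have dd : 0 < 128 * del N ^+ 2 by rewrite pmulr_rgt0.
  rewrite (ler_pdivlMr _ _ dd).
  move: dle; rewrite -/(b alpha) ler_pdivlMr // => dle.
  have d1 : del N ^+ 2 * N%:R `^ (1 - alpha) / b alpha <= 1.
    by rewrite ler_pdivrMr ?b0 // mul1r.
  have := ler_wpM2l (ltW p2) d1; rewrite mulr1; apply: le_trans.
  have : b alpha != 0 by rewrite gt_eqF // b0.
  move: (b alpha) (del N) (N%:R `^ (1 - alpha)) => B D Y B0.
  by rewrite le_eqVlt; apply/orP; left; apply/eqP; field.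
- move=> d S.
  have [M1 hM1] := atypical_probability_le hp hq k0.
  have p16 : 0 < p / 16 by rewrite divr_gt0.
  have [M2 hM2] := degree_scale_small p16.
  apply: (@large_probabilityP _ _ _ _ (2 * mixing_cost p + 4 * (1 + kappa))
     (maxn (maxn M1 M2) 2)).
  + have cost0 : 0 <= mixing_cost p.
      rewrite /mixing_cost addr_ge0 //; first by rewrite mulr_ge0 // sqr_ge0.
      by rewrite divr_ge0 // exprn_ge0 // ltW.
    by move: k0 cost0; lra.
  + by move=> N1 N2; exact: measurable_separates.
  move=> N1 N2 c1 c2; rewrite !geq_max => /andP[/andP[h1 h2] h3].
  have [n1 n2] : (1 < N1)%N /\ (1 < N2)%N.
    by split; [apply: leq_trans h3 (geq_minl _ _)|apply: leq_trans h3 (geq_minr _ _)].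
  pose e1 : upair N1 := exist _ (Ordinal (ltnW n1), Ordinal n1) isT.
  pose e2 : upair N2 := exist _ (Ordinal (ltnW n2), Ordinal n2) isT.
  apply: le_trans (hM1 N1 N2 (S N1 N2) e1 e2 c1 c2 h1).
  apply: le_measure; rewrite ?inE.
  + by apply: measurableC; exact: measurable_separates.
  + exact: (measurable_config _ (fun s => ~ typical p q e1 e2 (del (minn N1 N2)) s)).
  move=> w /= nsep typ; apply: nsep => x y sol.
  have dN : 0 < del (minn N1 N2) <= p / 16 by rewrite degree_scale_gt0 //= hM2.
  apply: (typical_separates hp hq dN typ).
  apply: eq_solution sol => [i k ik|j l jl|i j].
  + by rewrite group1_draw.
  + by rewrite group2_draw.
  + by rewrite between_draw.
Qed.
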